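(* Let $n\ge3$, put $m=n-1$, and let $0<\delta<1/m$. Define $$a_\delta=\frac{m(1-\delta)}{1-m\delta}.$$ Then the metric $$g_\delta=dt^2+(a_\delta-\cos t)^2g_{\mathbb S^m}$$ on $\mathbb S^1\times\mathbb S^m$ satisfies the Ricci sign trichotomy, has both Ricci signs (the Ricci tensor is positive definite at some points and negative definite at others), and obeys $\delta_{\mathrm{Ric}}\ge\delta$ at every non-Ricci-flat point, with equality somewhere. Its optimal global lower pinching constant is therefore exactly $\delta$. The lift to $\mathbb R\times\mathbb S^m$ is complete and has the same properties.
   Context: $\mathbb S^1=\mathbb R/2\pi\mathbb Z$ with coordinate $t$; $g_{\mathbb S^m}$ is the round metric of constant sectional curvature $1$. A Riemannian manifold satisfies the Ricci sign trichotomy if at every point the Ricci tensor is positive definite, negative definite, or zero. At a non-Ricci-flat point $p$ with Ricci eigenvalues $\lambda_1,\dots,\lambda_n$ (relative to the metric), $\delta_{\mathrm{Ric}}(p)=\min_i|\lambda_i|/\max_i|\lambda_i|$. *)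

(* Defs.v *)
From HB Require Import structures.
From mathcomp Require Import all_boot all_order all_algebra.
From mathcomp Require Import all_classical all_reals all_analysis.
From mathcomp Require Import ring.
Set Implicit Arguments.
Unset Strict Implicit.
Unset Printing Implicit Defensive.
Import Order.TTheory GRing.Theory Num.Theory.
Import numFieldNormedType.Exports.
Local Open Scope classical_set_scope.
Local Open Scope ring_scope.

Section Coordinates.
Context (R : realType) (n : nat).
Implicit Types (U : set 'rV[R]_n) (f : 'rV[R]_n -> R) (g : 'rV[R]_n -> 'M[R]_n).

Definition partial (i : 'I_n) f (u : 'rV[R]_n) : R := 'D_(delta_mx 0 i) f u.

Fixpoint of_class_C (k : nat) U f : Prop :=
  if k is k'.+1 then
    (forall u, U u -> differentiable f u) /\
    (forall i, of_class_C k' U (partial i f))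
  else forall u, U u -> {for u, continuous f}.

Definition smooth_on U f := forall k, of_class_C k U f.

Definition posdef (A : 'M[R]_n) :=
  forall v : 'rV[R]_n, v != 0 -> 0 < (v *m A *m v^T) 0 0.

(* christoffel g i j k is the coefficient usually written with upper index i
   and lower indices j, k. *)
Definition christoffel g (i j k : 'I_n) (u : 'rV[R]_n) : R :=
  2^-1 * \sum_l invmx (g u) i l *
    (partial j (fun w => g w l k) u + partial k (fun w => g w l j) u
     - partial l (fun w => g w j k) u).

(* The contraction Ric_jk = R^i_{kij} of the curvature tensor, with the sign
   for which round spheres have positive Ricci curvature. *)
Definition ricci g (u : 'rV[R]_n) : 'M[R]_n :=
  \matrix_(j, k)
    (\sum_i (partial i (christoffel g i j k) u
             - partial j (christoffel g i i k) u)
     + \sum_i \sum_l (christoffel g i i l u * christoffel g l j k u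
                      - christoffel g i j l u * christoffel g l i k u)).

End Coordinates.

(* A manifold of dimension n is presented by local parametrizations
   param c : dom c -> pts (the inverses of its charts), and a metric by its
   Gram matrices tensor c in the corresponding coordinates; the conditions
   that these data have to satisfy are collected in [riemannian]. *)
Record atlas (R : realType) (n : nat) := Atlas {
  pts :> Type;
  chart : Type;
  dom : chart -> set 'rV[R]_n;
  param : chart -> 'rV[R]_n -> pts;
  tensor : chart -> 'rV[R]_n -> 'M[R]_n }.

Section Riemannian.
Context (R : realType) (n : nat) (M : atlas R n).

(* riem_transition gives, around every point of an overlap, a smooth
   coordinate change tau that carries one expression of the metric to the
   other; in particular overlaps are open in the coordinates. *)
Record riemannian : Prop := Riemannian {
  riem_open : forall c : chart M, open (dom c);
  riem_cover : forall p : M, exists c u, dom c u /\ param c u = p;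
  riem_inj : forall (c : chart M) u v,
    dom c u -> dom c v -> param c u = param c v -> u = v;
  riem_transition : forall (c c' : chart M) u v,
    dom c u -> dom c' v -> param c u = param c' v ->
    exists (U : set 'rV[R]_n) (tau : 'rV[R]_n -> 'rV[R]_n),
      [/\ open_nbhs u U,
          tau u = v,
          forall w, U w -> dom c' (tau w) /\ param c' (tau w) = param c w,
          forall j, smooth_on U (fun w => tau w 0 j)
        & tensor c u = 'J tau u *m tensor c' v *m ('J tau u)^T];
  riem_smooth : forall (c : chart M) i j,
    smooth_on (dom c) (fun u => tensor c u i j);
  riem_sym : forall (c : chart M) u, dom c u -> (tensor c u)^T = tensor c u;
  riem_pos : forall (c : chart M) u, dom c u -> posdef (tensor c u) }.

Definition ricci_pos (p : M) := forall (c : chart M) u,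
  dom c u -> param c u = p -> posdef (ricci (tensor c) u).

Definition ricci_neg (p : M) := forall (c : chart M) u,
  dom c u -> param c u = p -> posdef (- ricci (tensor c) u).

Definition ricci_flat (p : M) := forall (c : chart M) u,
  dom c u -> param c u = p -> ricci (tensor c) u = 0.

Definition ricci_trichotomy :=
  forall p : M, ricci_pos p \/ ricci_neg p \/ ricci_flat p.

(* v |-> v *m (Ric *m g^-1) is the Ricci endomorphism acting on row vectors. *)
Definition ricci_eigenvalues (p : M) : set R :=
  [set l | exists (c : chart M) u, [/\ dom c u, param c u = p
    & eigenvalue (ricci (tensor c) u *m invmx (tensor c u)) l]].

(* The set of eigenvalues is finite, so inf and sup are min and max. *)
Definition delta_ric (p : M) : R :=
  inf [set `|l| | l in ricci_eigenvalues p] /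
  sup [set `|l| | l in ricci_eigenvalues p].

Definition pinching_constant : R :=
  sup [set k | forall p : M, ~ ricci_flat p -> k <= delta_ric p].

Definition C1_curve (c : chart M) (u : R -> 'rV[R]_n) :=
  [/\ forall s, derivable u s 1, continuous (derive1 u)
    & forall s, s \in `[0, 1] -> dom c (u s)].

Definition curve_length (c : chart M) (u : R -> 'rV[R]_n) : \bar R :=
  (\int[lebesgue_measure]_(s in `[0%R, 1%R])
     (Num.sqrt ((derive1 u s *m tensor c (u s) *m (derive1 u s)^T) 0 0))%:E)%E.

(* joined p q l: a piecewise C^1 curve of length l goes from p to q. Such a
   curve is a concatenation of C^1 curves, each contained in one chart and
   reparametrized by [0, 1]. *)
Inductive joined : M -> M -> \bar R -> Prop :=
| joined_nil p : joined p p 0%E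
| joined_cons c u q l : C1_curve c u -> joined (param c (u 1)) q l ->
    joined (param c (u 0)) q (curve_length c u + l)%E.

Definition riemannian_dist (p q : M) : \bar R := ereal_inf [set l | joined p q l].

Definition riemannian_complete := forall x : nat -> M,
  (forall e : R, 0 < e -> exists N, forall i j, (N <= i)%N -> (N <= j)%N ->
     (riemannian_dist (x i) (x j) < e%:E)%E) ->
  exists p : M, forall e : R, 0 < e -> exists N, forall i, (N <= i)%N ->
     (riemannian_dist (x i) p < e%:E)%E.

Record sharply_ricci_pinched (delta : R) : Prop := SharplyRicciPinched {
  pinched_trichotomy : ricci_trichotomy;
  pinched_pos : exists p : M, ricci_pos p;
  pinched_neg : exists p : M, ricci_neg p;
  pinched_ge : forall p : M, ~ ricci_flat p -> delta <= delta_ric p;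
  pinched_eq : exists2 p : M, ~ ricci_flat p & delta_ric p = delta;
  pinched_optimal : pinching_constant = delta }.

End Riemannian.

Section Circle.
Context (R : realType).

Definition cong_2pi (s t : R) : bool :=
  `[< exists k : int, t = s + k%:~R * (2 * pi) >].

Lemma cong_2pi_equiv : equiv_class_of cong_2pi.
Proof.
split.
- by move=> s; apply/asboolP; exists 0; rewrite mul0r addr0.
- have sym s t : cong_2pi s t -> cong_2pi t s.
    move=> /asboolP[k ->]; apply/asboolP; exists (- k).
    by rewrite mulrNz mulNr addrK.
  by move=> s t; apply/idP/idP; exact: sym.
- move=> s t r /asboolP[k ->] /asboolP[l ->]; apply/asboolP; exists (k + l).
  by rewrite intrD; ring.
Qed.

Canonical cong_2pi_rel := EquivRelPack cong_2pi_equiv.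

Definition circle := {eq_quot cong_2pi}%qT.

End Circle.

Section Sphere.
Context (R : realType) (m : nat).

Definition sphere := {x : 'rV[R]_(m + 1) | (x *m x^T) 0 0 == 1}.

Definition normsq (y : 'rV[R]_m) : R := (y *m y^T) 0 0.

(* Inverse stereographic projection from the pole (0, (-1)^b). *)
Definition stereo (b : bool) (y : 'rV[R]_m) : 'rV[R]_(m + 1) :=
  row_mx ((2 / (1 + normsq y)) *: y)
         ((-1) ^+ b * (normsq y - 1) / (1 + normsq y))%:M.

Lemma stereo_sphere b y : (stereo b y *m (stereo b y)^T) 0 0 == 1.
Proof.
have ge0 : 0 <= normsq y.
  by rewrite /normsq mxE sumr_ge0// => i _; rewrite mxE -expr2 sqr_ge0.
have nz : 1 + normsq y != 0 by rewrite gt_eqF// ltr_pwDl.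
rewrite /stereo tr_row_mx mul_row_col linearZ /= -scalemxAl -scalemxAr scalerA.
rewrite tr_scalar_mx -scalar_mxM [in X in X == _]mxE [X in X + _]mxE.
rewrite -/(normsq y) mxE mulr1n.
by case: b; rewrite ?expr0 ?expr1; apply/eqP; field.
Qed.

Definition stereo_pt (b : bool) (y : 'rV[R]_m) : sphere :=
  exist (fun x : 'rV[R]_(m + 1) => (x *m x^T) 0 0 == 1)
        (stereo b y) (stereo_sphere b y).

(* The round metric, induced by the Euclidean metric of R^(m+1), in
   stereographic coordinates. *)
Definition round_metric (b : bool) (y : 'rV[R]_m) : 'M[R]_m :=
  'J (stereo b) y *m ('J (stereo b) y)^T.

End Sphere.

Section Warped.
Context (R : realType) (m : nat) (f : R -> R).
Implicit Type u : 'rV[R]_(1 + m).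

Definition tcoord u : R := lsubmx u 0 0.

Definition warped_metric (b : bool) u : 'M[R]_(1 + m) :=
  block_mx 1%:M 0 0 (f (tcoord u) ^+ 2 *: round_metric b (rsubmx u)).

(* dt^2 + f(t)^2 g_{S^m} on R x S^m *)
Definition line_warped : atlas R (1 + m) :=
  @Atlas R (1 + m) (R * sphere R m)%type bool
    (fun=> setT)
    (fun b u => (tcoord u, stereo_pt b (rsubmx u)))
    warped_metric.

Definition covering (p : R * sphere R m) : circle R * sphere R m :=
  (\pi_(circle R)%qT p.1, p.2).

(* dt^2 + f(t)^2 g_{S^m} on (R/2piZ) x S^m, for f periodic of period 2 pi; the
   chart (r, b) uses the representatives t in ]r - pi, r + pi[. Its
   parametrizations are those of line_warped followed by the covering map, with
   the same Gram matrices: line_warped carries the lifted metric. *)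
Definition circle_warped : atlas R (1 + m) :=
  @Atlas R (1 + m) (circle R * sphere R m)%type (R * bool)%type
    (fun c => [set u | c.1 - pi < tcoord u < c.1 + pi])
    (fun c u => covering (param (a := line_warped) c.2 u))
    (fun c => tensor (a := line_warped) c.2).

End Warped.

(* Main.v *)
Require Import Defs.
From HB Require Import structures.
From mathcomp Require Import all_boot all_order all_algebra.
From mathcomp Require Import all_classical all_reals all_analysis.
From mathcomp Require Import ring lra.
Set Implicit Arguments.
Unset Strict Implicit.
Unset Printing Implicit Defensive.
Import Order.TTheory GRing.Theory Num.Theory.
Import numFieldNormedType.Exports.
Local Open Scope classical_set_scope.
Local Open Scope ring_scope.

(** The metric is diagonal in the coordinates (t, y), y stereographic, and every
    Christoffel symbol is a product p(t) q(y). This gives the Ricci eigenvalues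
    - m f'' / f and ((m - 1) (1 - f'^2) - f f'') / f^2, which for f = a - cos t
    and x = cos t are - m x / (a - x) and - x (a - m x) / (a - x)^2. As a > m,
    both have the sign of - x, and the quotient of their absolute values,
    (a - m x) / (m (a - x)), is smallest at x = 1, where it equals delta.
    For completeness, t and (a - 1) times each Euclidean coordinate of the sphere
    are 1-Lipschitz, so that a Cauchy sequence converges in some chart, where
    distances are bounded by lengths of straight segments. *)


(** * Gradients, and a class of functions closed under differentiation *)

Section Gradient.
Context (R : realType) (n : nat).
Implicit Types (U : set 'rV[R]_n) (f g : 'rV[R]_n -> R) (u : 'rV[R]_n).

(** For f = a - cos t one has 1 - f'^2 = x^2 and f'' = x, so that x factors out of both Ricci
    eigenvalues: they vanish together and change sign together, which is the trichotomy. The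
    quotient (a - m x) / (m (a - x)) decreases in x because m > 1; setting its value at x = 1, (a -
    m) / (m (a - 1)), equal to delta and solving for a gives the stated constant. The line and the
    circle have the same Gram matrices. The curvature is therefore computed once, for either pole of
    projection, and transferred to both manifolds through a function X that equals cos t in every
    chart. The sphere needs two stereographic charts, exchanged by the inversion y / |y|^2, so every
    coordinate change is a translation of t together with the identity or this inversion. In a fixed
    chart a Cauchy sequence may run off to the pole of projection. Its limit is therefore found in R
    x R^(m+1), and the chart is chosen afterwards, with its pole away from the limit. *)

Definition has_grad f u (d : 'I_n -> R) :=
  differentiable f u /\ forall i, partial i f u = d i.

Lemma has_grad_ext f u d d' : (forall i, d i = d' i) ->
  has_grad f u d -> has_grad f u d'.
Proof. by move=> e [df pf]; split=> // i; rewrite pf e. Qed.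

(** Both the first-order expansion and the directional derivatives depend only on the germ of the
    function at u. *)
Lemma has_grad_near f g u d : (\forall w \near u, f w = g w) ->
  has_grad f u d -> has_grad g u d.
Proof.
move=> fg [df pf]; split; last first.
  by move=> i; rewrite -pf /partial; apply/esym/near_eq_derive.
apply/diffP.
(* The differential of g is a linear map selected by [get], so it is enough to exhibit one
   continuous linear map with the expansion; the differential of f is one. *)
apply: (@getPex _ (fun l : {linear 'rV[R]_n -> R} => continuous l /\
  forall y, g y = g (lim (nbhs u)) + l (y - lim (nbhs u))
                  +o_(y \near u) (y - lim (nbhs u)))).
have [cf Ef] := (diffP _ _).1 df.
exists ('d f u); split=> //.
rewrite lim_id// in Ef *.
have Ef' : f = (fun y => f u + 'd f u (y - u)) +o_ (nbhs u) (fun y => y - u).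
  by rewrite funeqE.
suff Eg : g = (fun y => g u + 'd f u (y - u)) +o_ (nbhs u) (fun y => y - u).
  by move: Eg; rewrite funeqE.
apply/eqaddoP => e e0.
have /eqaddoP/(_ e e0) := Ef'.
have fgu := nbhs_singleton fg.
apply: filterS2 fg => w fgw; rewrite !fctE -fgw.
by rewrite -fgu.
Qed.

Lemma has_grad_cst (a : R) u : has_grad (cst a) u (fun=> 0).
Proof. by split=> // i; rewrite /partial derive_cst. Qed.

Lemma has_gradD f g u d e : has_grad f u d -> has_grad g u e ->
  has_grad (fun w => f w + g w) u (fun i => d i + e i).
Proof.
move=> [df pf] [dg pg]; split; first exact: differentiableD.
move=> i; rewrite /partial deriveD; try exact: diff_derivable.
by rewrite -!/(partial _ _ _) pf pg.
Qed.

Lemma has_gradM f g u d e : has_grad f u d -> has_grad g u e ->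
  has_grad (fun w => f w * g w) u (fun i => d i * g u + f u * e i).
Proof.
move=> [df pf] [dg pg]; split; first exact: differentiableM.
move=> i; rewrite /partial deriveM; try exact: diff_derivable.
by rewrite -!/(partial _ _ _) pf pg addrC [in LHS]/GRing.scale/= [g u * _]mulrC.
Qed.

Lemma has_grad_comp (h : R -> R) f u d k :
  has_grad f u d -> is_derive (f u) 1 h k ->
  has_grad (fun w => h (f w)) u (fun i => k * d i).
Proof.
move=> [df pf] [dh hk].
have dh' : differentiable h (f u) by apply/derivable1_diffP.
split; first exact: differentiable_comp.
move=> i; rewrite /partial deriveE; last exact: differentiable_comp.
rewrite diff_comp//= -[X in 'd h _ X]mulr1 -[_ * 1]/(_ *: (1 : R)) linearZ/=.
by rewrite -!deriveE// hk -/(partial _ _ _) pf mulrC.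
Qed.

Lemma has_gradV f u d : f u != 0 -> has_grad f u d ->
  has_grad (fun w => (f w)^-1) u (fun i => - d i / f u ^+ 2).
Proof.
move=> fn0 [df pf]; split; first exact: differentiableV.
move=> i; rewrite /partial deriveV//; last exact: diff_derivable.
by rewrite -/(partial _ _ _) pf scaleNr mulNr mulrC.
Qed.

Lemma has_grad_coord u (j : 'I_n) :
  has_grad (fun w => w 0 j) u (fun i => (i == j)%:R).
Proof.
have L : linear (fun w : 'rV[R]_n => w 0 j : R) by move=> k x y; rewrite !mxE.
pose l : {linear 'rV[R]_n -> R} := HB.pack (fun w : 'rV[R]_n => w 0 j : R) (GRing.isLinear.Build _ _ _ _ _ L).
split; first exact: (differentiable_coord u 0 j).
move=> i; rewrite /partial deriveE; last exact: (differentiable_coord u 0 j).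
rewrite -/(l : _ -> _) diff_lin; last first.
  by move=> w; apply: differentiable_continuous; exact: differentiable_coord.
by rewrite /= mxE eqxx eq_sym.
Qed.

Lemma has_grad_sum m (F : 'I_m -> 'rV[R]_n -> R) u D :
  (forall k, has_grad (F k) u (D k)) ->
  has_grad (fun w => \sum_k F k w) u (fun i => \sum_k D k i).
Proof.
elim: m F D => [|m IH] F D h.
  have -> : (fun w => \sum_k F k w) = cst 0 by apply/funext=> w; rewrite big_ord0.
  by apply: has_grad_ext (has_grad_cst 0 u) => i; rewrite big_ord0.
have -> : (fun w => \sum_k F k w) = (fun w => F ord0 w + \sum_k F (lift ord0 k) w).
  by apply/funext=> w; rewrite big_ord_recl.
apply: has_grad_ext (has_gradD (h ord0) (IH _ _ (fun k => h (lift ord0 k)))) => i.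
by rewrite [RHS]big_ord_recl.
Qed.

(* A class of functions closed under partial derivatives, which is what makes
   its members smooth. *)
Inductive elem U : ('rV[R]_n -> R) -> Prop :=
| elem_cst a : elem U (cst a)
| elem_coord j : elem U (fun w => w 0 j)
| elemD f g : elem U f -> elem U g -> elem U (fun w => f w + g w)
| elemM f g : elem U f -> elem U g -> elem U (fun w => f w * g w)
| elemV f : (forall u, U u -> f u != 0) -> elem U f -> elem U (fun w => (f w)^-1)
| elem_sin f : elem U f -> elem U (fun w => sin (f w))
| elem_cos f : elem U f -> elem U (fun w => cos (f w)).

Lemma elemN U f : elem U f -> elem U (fun w => - f w).
Proof.
move=> h; have -> : (fun w => - f w) = (fun w => cst (- 1) w * f w).
  by apply/funext=> w; rewrite mulN1r.
by apply: elemM => //; exact: elem_cst.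
Qed.

Lemma elem_sum U m (F : 'I_m -> 'rV[R]_n -> R) :
  (forall k, elem U (F k)) -> elem U (fun w => \sum_k F k w).
Proof.
elim: m F => [|m IH] F h.
  have -> : (fun w => \sum_k F k w) = cst 0 by apply/funext=> w; rewrite big_ord0.
  exact: elem_cst.
have -> : (fun w => \sum_k F k w) = (fun w => F ord0 w + \sum_k F (lift ord0 k) w).
  by apply/funext=> w; rewrite big_ord_recl.
by apply: elemD => //; exact: IH.
Qed.

(** Each differentiation rule expresses the gradient by members of the same class, so that it can be
    differentiated again. *)
Lemma elem_has_grad U f : elem U f ->
  exists2 d, (forall i, elem U (d i)) &
    forall u, U u -> has_grad f u (fun i => d i u).
Proof.
elim=> {f} [a|j|f g ef [d ed hd] eg [e ee he]|f g ef [d ed hd] eg [e ee he]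
  |f fn0 ef [d ed hd]|f ef [d ed hd]|f ef [d ed hd]].
- by exists (fun=> cst 0) => [i|u _]; [exact: elem_cst|exact: has_grad_cst].
- exists (fun i => cst (i == j)%:R) => [i|u _]; first exact: elem_cst.
  exact: has_grad_coord.
- exists (fun i w => d i w + e i w) => [i|u Uu]; first exact: elemD.
  by apply: has_gradD; [exact: hd|exact: he].
- exists (fun i w => d i w * g w + f w * e i w) => [i|u Uu].
    by apply: elemD; exact: elemM.
  by apply: has_gradM; [exact: hd|exact: he].
- exists (fun i w => - d i w * (f w * f w)^-1) => [i|u Uu].
    apply: elemM; [exact: elemN|apply: elemV; last exact: elemM].
    by move=> u Uu; rewrite mulf_neq0// fn0.
  exact: has_gradV (fn0 _ Uu) (hd _ Uu).
- exists (fun i w => cos (f w) * d i w) => [i|u Uu].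
    by apply: elemM => //; exact: elem_cos.
  exact: has_grad_comp (hd _ Uu) _.
- exists (fun i w => - sin (f w) * d i w) => [i|u Uu].
    by apply: elemM => //; apply: elemN; exact: elem_sin.
  exact: has_grad_comp (hd _ Uu) _.
Qed.

(** Needed because [partial i f] is known to agree with an explicit member of [elem] only on U. As U
    is open, this is agreement near every point of U, which continuity and derivatives respect. *)
Lemma of_class_C_eq k U f g : open U -> (forall u, U u -> f u = g u) ->
  of_class_C k U f -> of_class_C k U g.
Proof.
move=> oU.
have H f' g' u : (forall u, U u -> f' u = g' u) -> U u ->
    \forall w \near u, f' w = g' w.
  move=> e Uu; have : nbhs u U by exact: open_nbhs_nbhs.
  by apply: filterS => w; exact: e.
elim: k f g => [|k IH] f g e /=.
  move=> cf u Uu; have := cf u Uu; rewrite /prop_for /continuous_at -(e u Uu).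
  by apply: cvg_trans; exact: (near_eq_cvg (H _ _ _ e Uu)).
move=> [df pf]; split=> [u Uu|i].
  have [] // := @has_grad_near f g u (fun i => partial i f u) (H _ _ _ e Uu).
  by split=> //; exact: df.
apply: IH (pf i) => u Uu; rewrite /partial.
by apply: near_eq_derive; exact: H e Uu.
Qed.

Lemma elem_smooth U f : open U -> elem U f -> smooth_on U f.
Proof.
move=> oU + k; elim: k f => [|k IH] f ef /=; have [d ed hd] := elem_has_grad ef.
  by move=> u Uu; apply: differentiable_continuous; have [] := hd u Uu.
split=> [u Uu|i]; first by have [] := hd u Uu.
apply: of_class_C_eq (IH _ (ed i)) => // u Uu.
by have [_ ->] := hd u Uu.
Qed.

End Gradient.

(** * Jacobians and pullbacks of bilinear forms *)

Section Jacobian.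
Context (R : realType).

Lemma differentiable_row n p (tau : 'rV[R]_n -> 'rV[R]_p) u :
  (forall j, differentiable (fun w => tau w 0 j) u) -> differentiable tau u.
Proof.
move=> dtau.
have -> : tau = (\sum_j (fun w => tau w 0 j *: (delta_mx 0 j : 'rV[R]_p))).
  by apply/funext=> w; rewrite [LHS]row_sum_delta fct_sumE.
by apply: differentiable_sum => j; exact: differentiableZl.
Qed.

(** Vectors are rows and the Jacobian acts on the right, so its row index is the direction of
    differentiation. *)
Lemma jacobian_partial n p (tau : 'rV[R]_n -> 'rV[R]_p) u i j :
  (forall j, differentiable (fun w => tau w 0 j) u) ->
  'J tau u i j = partial i (fun w => tau w 0 j) u.
Proof.
move=> dtau; have dt := differentiable_row dtau.
have E (B : 'M[R]_(n, p)) : B i j = ((delta_mx 0 i : 'rV_n) *m B) 0 j.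
  by rewrite -rowE mxE.
rewrite [LHS]E; transitivity (('D_(delta_mx 0 i) tau u) 0 j).
  by congr (fun_of_matrix _ 0 j); rewrite deriveEjacobian.
by rewrite derive_mx ?mxE//; exact: diff_derivable.
Qed.

(** The pullback of a bilinear form in coordinates: with A = 1 it gives the induced metric of the
    sphere, with A a warped metric its behaviour under coordinate changes. *)
Lemma gram_jacobian n p (tau : 'rV[R]_n -> 'rV[R]_p) u (A : 'M[R]_p) i j
    (d : 'I_p -> 'I_n -> R) :
  (forall k, has_grad (fun w => tau w 0 k) u (d k)) ->
  ('J tau u *m A *m ('J tau u)^T) i j =
  \sum_k \sum_l d k i * A k l * d l j.
Proof.
move=> h; have dt k : differentiable (fun w => tau w 0 k) u by have [] := h k.
have E (B : 'M[R]_(n, p)) :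
    (B *m A *m B^T) i j = \sum_k \sum_l B i k * A k l * B j l.
  rewrite mxE exchange_big/=; apply: eq_bigr => l _.
  by rewrite !mxE big_distrl.
rewrite [LHS]E; apply: eq_bigr => k _; apply: eq_bigr => l _.
rewrite (jacobian_partial i k dt) (jacobian_partial j l dt).
by have [_ ->] := h k; have [_ ->] := h l.
Qed.

End Jacobian.

Lemma sum_delta (R : comPzRingType) n (F : 'I_n -> R) i :
  \sum_k F k * (i == k)%:R = F i.
Proof.
rewrite (bigD1 i)//= eqxx mulr1 big1 ?addr0// => k ki.
by rewrite eq_sym (negbTE ki) mulr0.
Qed.

(** * The round metric in stereographic coordinates *)

Section Round.
Context (R : realType) (m : nat).
Implicit Types (y : 'rV[R]_m).

(** The conformal factor of stereographic projection. Its gradient is again polynomial in [conf] and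
    the coordinates, which keeps the later derivatives free of denominators. *)
Definition conf y : R := 2 / (1 + normsq y).

Lemma normsqE y : normsq y = \sum_k y 0 k * y 0 k.
Proof. by rewrite /normsq mxE; apply: eq_bigr => k _; rewrite mxE. Qed.

Lemma normsq_ge0 y : 0 <= normsq y.
Proof. by rewrite normsqE sumr_ge0// => k _; rewrite -expr2 sqr_ge0. Qed.

Lemma normsq1_gt0 y : 0 < 1 + normsq y.
Proof. by rewrite ltr_pwDl// normsq_ge0. Qed.

Lemma conf_gt0 y : 0 < conf y.
Proof. by rewrite divr_gt0// normsq1_gt0. Qed.

Lemma has_grad_normsq y : has_grad (@normsq R m) y (fun i => 2 * y 0 i).
Proof.
have -> : @normsq R m = (fun w => \sum_k w 0 k * w 0 k).
  by apply/funext => w; exact: normsqE.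
apply: has_grad_ext (has_grad_sum (fun k => has_gradM (has_grad_coord y k)
  (has_grad_coord y k))) => i.
rewrite -(sum_delta (fun k => 2 * y 0 k) i); apply: eq_bigr => k _.
by ring.
Qed.

Lemma has_grad_conf y : has_grad conf y (fun i => - conf y ^+ 2 * y 0 i).
Proof.
have n0 := lt0r_neq0 (normsq1_gt0 y).
have := has_gradM (has_grad_cst 2 y)
  (has_gradV n0 (has_gradD (has_grad_cst 1 y) (has_grad_normsq y))).
apply: has_grad_ext => i; rewrite /conf /= /cst; field.
exact: n0.
Qed.

Lemma stereo_lshift b y k : stereo b y 0 (lshift 1 k) = conf y * y 0 k.
Proof. by rewrite row_mxEl mxE. Qed.

Lemma stereo_rshift b y : stereo b y 0 (rshift m 0) = (-1) ^+ b * (1 - conf y).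
Proof.
rewrite row_mxEr mxE eqxx mulr1n /conf.
have n0 := lt0r_neq0 (normsq1_gt0 y).
by field.
Qed.

Definition stereo_grad (b : bool) y (k : 'I_(m + 1)) (i : 'I_m) : R :=
  match fintype.split k with
  | inl k => - conf y ^+ 2 * y 0 i * y 0 k + conf y * (i == k)%:R
  | inr _ => (-1) ^+ b * (conf y ^+ 2 * y 0 i)
  end.

Lemma has_grad_stereo b y k :
  has_grad (fun w => stereo b w 0 k) y (stereo_grad b y k).
Proof.
rewrite /stereo_grad; case: (split_ordP k) => j ->.
  rewrite (_ : (fun _ => _) = (fun w => conf w * w 0 j)); last first.
    by apply/funext => w; rewrite stereo_lshift.
  exact: has_gradM (has_grad_conf y) (has_grad_coord y j).
rewrite ord1 (_ : (fun _ => _) = (fun w => cst ((-1) ^+ b) w *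
    (cst 1 w + cst (-1) w * conf w))); last first.
  by apply/funext => w; rewrite stereo_rshift /cst mulN1r.
apply: has_grad_ext (has_gradM (has_grad_cst _ y) (has_gradD (has_grad_cst _ y)
  (has_gradM (has_grad_cst _ y) (has_grad_conf y)))) => i.
by rewrite /cst; ring.
Qed.

Lemma round_metricE b y : round_metric b y = (conf y ^+ 2)%:M.
Proof.
apply/matrixP => i j; rewrite [RHS]mxE.
transitivity (('J (stereo b) y *m 1%:M *m ('J (stereo b) y)^T) i j).
  by rewrite mulmx1.
rewrite [LHS](gram_jacobian 1%:M i j (has_grad_stereo b y)).
under eq_bigr => k _.
  rewrite (bigD1 k)//= big1 ?addr0; last first.
    by move=> l lk; rewrite mxE eq_sym (negbTE lk) mulr0n mulr0 mul0r.
  rewrite mxE eqxx mulr1n mulr1; over.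
rewrite big_split_ord/= big_ord1/= /stereo_grad.
under eq_bigr do rewrite (unsplitK (inl _)).
rewrite (unsplitK (inr _)).
(* The last coordinate of the sphere contributes a product of two equal signs, so the pole b
   disappears here. *)
transitivity (conf y ^+ 4 * y 0 i * y 0 j * \sum_k (y 0 k * y 0 k)
  - conf y ^+ 3 * y 0 i * \sum_k y 0 k * (j == k)%:R
  - conf y ^+ 3 * y 0 j * \sum_k y 0 k * (i == k)%:R
  + conf y ^+ 2 * \sum_k (i == k)%:R * (j == k)%:R + conf y ^+ 4 * y 0 i * y 0 j).
  rewrite !mulr_sumr -!sumrB -big_split/= -mulrA; congr (_ + _).
    by apply: eq_bigr => k _; ring.
  by case: b; ring.
rewrite !sum_delta -normsqE.
(* The relation conf y * (1 + normsq y) = 2 makes the coefficient of y_i y_j vanish, leaving a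
   multiple of the identity. *)
have -> : normsq y = 2 / conf y - 1.
  by rewrite /conf; field; rewrite lt0r_neq0// normsq1_gt0.
rewrite eq_sym -mulr_natr; field.
by rewrite lt0r_neq0// conf_gt0.
Qed.

End Round.

(** * Functions of t and functions of y on the product *)

Section Split.
Context (R : realType) (m : nat).
Implicit Types (u : 'rV[R]_(1 + m)).

Lemma has_grad_tcoord u :
  has_grad (@tcoord R m) u (fun i => (i == lshift m 0)%:R).
Proof.
rewrite (_ : @tcoord R m = fun w => w 0 (lshift m 0)); last first.
  by apply/funext => w; rewrite /tcoord mxE.
exact: has_grad_coord.
Qed.

Lemma has_grad_rsubmx (q : 'rV[R]_m -> R) dq u : has_grad q (rsubmx u) dq ->
  has_grad (fun w => q (rsubmx w)) u
    (fun i => match fintype.split i with inl _ => 0 | inr a => dq a end).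
Proof.
move=> [dfq pq].
have drs : differentiable (fun w : 'rV[R]_(1 + m) => rsubmx w) u.
  exact: differentiable_rsubmx.
have L : linear (fun w : 'rV[R]_(1 + m) => rsubmx w).
  by move=> k x y; rewrite linearP.
pose l : {linear 'rV[R]_(1 + m) -> 'rV[R]_m} := HB.pack
  (fun w : 'rV[R]_(1 + m) => rsubmx w) (GRing.isLinear.Build _ _ _ _ _ L).
have cl : continuous l.
  by move=> w; apply: differentiable_continuous; exact: differentiable_rsubmx.
split; first exact: differentiable_comp.
move=> i; rewrite /partial deriveE; last exact: differentiable_comp.
rewrite -[fun w => _]/(q \o l) diff_comp//= diff_lin//=.
case: (split_ordP i) => j ->.
  rewrite (_ : rsubmx (delta_mx 0 (lshift m j) : 'rV[R]_(1 + m)) = 0) ?linear0//.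
  by apply/rowP => k; rewrite !mxE eqxx eq_rlshift.
rewrite (_ : rsubmx (delta_mx 0 (rshift 1 j) : 'rV[R]_(1 + m)) = delta_mx 0 j).
  by rewrite -pq /partial deriveE.
by apply/rowP => k; rewrite !mxE !eqxx eq_rshift.
Qed.

Lemma has_grad_splitM (p : R -> R) dp (q : 'rV[R]_m -> R) dq u :
  is_derive (tcoord u) 1 p dp -> has_grad q (rsubmx u) dq ->
  has_grad (fun w => p (tcoord w) * q (rsubmx w)) u
    (fun i => match fintype.split i with
              | inl _ => dp * q (rsubmx u)
              | inr a => p (tcoord u) * dq a end).
Proof.
move=> hp /has_grad_rsubmx hq.
apply: has_grad_ext (has_gradM (has_grad_comp (has_grad_tcoord u) hp) hq) => i.
case: (split_ordP i) => j ->; first by rewrite ord1 eqxx mulr1 mulr0 addr0.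
by rewrite eq_rlshift mulr0 mul0r add0r.
Qed.

End Split.

(** * Christoffel symbols of a diagonal metric *)

Section DiagonalMetric.
Context (R : realType) (n : nat) (g : 'rV[R]_n -> 'M[R]_n) (E : 'I_n -> 'rV[R]_n -> R).
Hypothesis gE : forall w i j, g w i j = E i w * (i == j)%:R.

Lemma partial_diag i j k u :
  partial k (fun w => g w i j) u = partial k (E i) u * (i == j)%:R.
Proof.
under [X in partial k X u]eq_fun do rewrite gE.
case: (i == j); rewrite ?mulr1 ?mulr0.
  by congr (partial _ _ _); apply/funext => w; rewrite mulr1.
rewrite (_ : (fun _ => _) = cst 0) ?[LHS]derive_cst//.
by apply/funext => w; rewrite mulr0.
Qed.

Lemma invmx_diag u i j : (forall i, E i u != 0) ->
  invmx (g u) i j = (E i u)^-1 * (i == j)%:R.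
Proof.
move=> En0; pose h : 'M[R]_n := \matrix_(i, j) ((E i u)^-1 * (i == j)%:R).
have gh : h *m g u = 1%:M.
  apply/matrixP => a b; rewrite !mxE.
  under eq_bigr do rewrite mxE gE mulrAC.
  rewrite sum_delta mulrA mulVf ?mul1r//.
have [_ <-] : h \in unitmx /\ h = invmx (g u).
  have [hu gu] := mulmx1_unit gh; split=> //.
  by rewrite -[RHS]mul1mx -gh mulmxK.
by rewrite mxE.
Qed.

(** The inverse matrix is diagonal, so only the term l = i of the sum survives. *)
Lemma christoffel_diag i j k u : (forall i, E i u != 0) ->
  christoffel g i j k u = (2 * E i u)^-1 *
    (partial j (E i) u * (i == k)%:R + partial k (E i) u * (i == j)%:R
     - partial i (E j) u * (j == k)%:R).
Proof.
move=> En0; rewrite /christoffel.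
under eq_bigr do rewrite invmx_diag// !partial_diag mulrAC.
by rewrite sum_delta mulrA invfM.
Qed.

End DiagonalMetric.

(** * Christoffel symbols of a warped product over the sphere, and their derivatives *)

Section WarpedMetric.
Context (R : realType) (m : nat) (f f1 f2 : R -> R) (b : bool).
Hypothesis fn0 : forall t, f t != 0.
Hypothesis df : forall t : R, is_derive t 1 f (f1 t).
Hypothesis df1 : forall t : R, is_derive t 1 f1 (f2 t).
Implicit Types (u : 'rV[R]_(1 + m)) (y : 'rV[R]_m).

Local Notation g := (@warped_metric R m f b).
Local Notation T := (lshift m (0 : 'I_1)).
Local Notation S := (@rshift 1 m).

Lemma warped_TT u : g u T T = 1.
Proof. by rewrite block_mxEul mxE. Qed.

Lemma warped_TS u j : g u T (S j) = 0.
Proof. by rewrite block_mxEur mxE. Qed.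

Lemma warped_ST u i : g u (S i) T = 0.
Proof. by rewrite block_mxEdl mxE. Qed.

Lemma warped_SS u i j :
  g u (S i) (S j) = f (tcoord u) ^+ 2 * conf (rsubmx u) ^+ 2 * (i == j)%:R.
Proof.
by rewrite block_mxEdr round_metricE mxE [X in _ * X]mxE -mulrA mulr_natr.
Qed.

Definition wdiag (i : 'I_(1 + m)) u : R :=
  if fintype.split i is inl _ then 1
  else f (tcoord u) ^+ 2 * conf (rsubmx u) ^+ 2.

Lemma wdiagT u : wdiag T u = 1.
Proof. by rewrite /wdiag (unsplitK (inl _)). Qed.

Lemma wdiagS i u : wdiag (S i) u = f (tcoord u) ^+ 2 * conf (rsubmx u) ^+ 2.
Proof. by rewrite /wdiag (unsplitK (inr _)). Qed.

Lemma warped_diag u i j : g u i j = wdiag i u * (i == j)%:R.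
Proof.
case: (split_ordP i) => i' ->; case: (split_ordP j) => j' ->; rewrite ?ord1.
- by rewrite warped_TT wdiagT eqxx mulr1.
- by rewrite warped_TS eq_lrshift mulr0.
- by rewrite warped_ST eq_rlshift mulr0.
- by rewrite warped_SS wdiagS eq_rshift.
Qed.

Lemma wdiag_neq0 u i : wdiag i u != 0.
Proof.
rewrite /wdiag; case: fintype.split => _; first exact: oner_neq0.
by rewrite mulf_neq0// expf_neq0// lt0r_neq0// conf_gt0.
Qed.

Lemma partial_wdiagT k u : partial k (wdiag T) u = 0.
Proof.
rewrite (_ : wdiag T = cst 1) ?[LHS]derive_cst//.
by apply/funext => w; rewrite wdiagT.
Qed.

Lemma has_grad_wdiagS i u : has_grad (wdiag (S i)) u
  (fun k => match fintype.split k with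
            | inl _ => 2 * f (tcoord u) * f1 (tcoord u) * conf (rsubmx u) ^+ 2
            | inr a => f (tcoord u) ^+ 2 *
                       (- 2 * conf (rsubmx u) ^+ 3 * rsubmx u 0 a)
            end).
Proof.
rewrite (_ : wdiag (S i) = fun w => (f (tcoord w) * f (tcoord w)) *
    (conf (rsubmx w) * conf (rsubmx w))); last first.
  by apply/funext => w; rewrite wdiagS !expr2.
have hc := has_grad_conf (rsubmx u).
have hp : is_derive (tcoord u) 1 (fun t => f t * f t)
    (2 * f (tcoord u) * f1 (tcoord u)).
  apply: is_derive_eq (is_deriveM (df _) (df _)) _.
  by rewrite /GRing.scale/=; ring.
apply: has_grad_ext (has_grad_splitM hp (has_gradM hc hc)) => k.
by case: fintype.split => a; ring.
Qed.

Lemma partial_wdiagST i u : partial T (wdiag (S i)) u =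
  2 * f (tcoord u) * f1 (tcoord u) * conf (rsubmx u) ^+ 2.
Proof. by have [_ ->] := has_grad_wdiagS i u; rewrite (unsplitK (inl _)). Qed.

Lemma partial_wdiagSS i a u : partial (S a) (wdiag (S i)) u =
  f (tcoord u) ^+ 2 * (- 2 * conf (rsubmx u) ^+ 3 * rsubmx u 0 a).
Proof. by have [_ ->] := has_grad_wdiagS i u; rewrite (unsplitK (inr _)). Qed.

Let chrE i j k u := christoffel_diag warped_diag i j k (wdiag_neq0 u).

(** This symbol and the following ones are determined as functions, not only at a point, because the
    Ricci tensor differentiates them. *)
Lemma chr_TT k : christoffel g T T k = cst 0.
Proof.
apply/funext => u.
by rewrite chrE !partial_wdiagT !mul0r subr0 addr0 mulr0.
Qed.

Lemma chr_TkT k : christoffel g T k T = cst 0.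
Proof.
apply/funext => u; rewrite chrE !partial_wdiagT !mul0r; case: (split_ordP k) => j ->.
  by rewrite ord1 partial_wdiagT mul0r subr0 addr0 mulr0.
by rewrite eq_rlshift mulr0 subr0 addr0 mulr0.
Qed.

Lemma chr_TSS i j : christoffel g T (S i) (S j) =
  fun w => (- f (tcoord w) * f1 (tcoord w)) *
           (conf (rsubmx w) ^+ 2 * (i == j)%:R).
Proof.
apply/funext => u; rewrite chrE !partial_wdiagT partial_wdiagST wdiagT eq_rshift.
by field.
Qed.

Lemma chr_STT i : christoffel g (S i) T T = cst 0.
Proof.
apply/funext => u.
by rewrite chrE !partial_wdiagT eq_rlshift !mulr0 mul0r subr0 addr0 mulr0.
Qed.

Lemma chr_STS i j : christoffel g (S i) T (S j) =
  fun w => (f1 (tcoord w) / f (tcoord w)) * cst (i == j)%:R (rsubmx w).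
Proof.
apply/funext => u; rewrite chrE partial_wdiagT partial_wdiagST wdiagS eq_rshift.
rewrite eq_rlshift /cst !mulr0.
have c0 := lt0r_neq0 (conf_gt0 (rsubmx u)).
by field; rewrite c0 fn0.
Qed.

Lemma chr_SST i j : christoffel g (S i) (S j) T =
  fun w => (f1 (tcoord w) / f (tcoord w)) * cst (i == j)%:R (rsubmx w).
Proof.
apply/funext => u; rewrite chrE partial_wdiagST wdiagS eq_rshift.
rewrite !eq_rlshift /cst !mulr0.
have c0 := lt0r_neq0 (conf_gt0 (rsubmx u)).
by field; rewrite c0 fn0.
Qed.

(** The factor f^2 cancels, which leaves the symbols of a conformally flat metric: the derivative of
    log conf in direction j is - conf y_j. The factor [cst 1] keeps the shape p(t) q(y). *)
Lemma chr_SSS i j k : christoffel g (S i) (S j) (S k) =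
  fun w => cst 1 (tcoord w) * (- conf (rsubmx w) *
    (rsubmx w 0 j * (i == k)%:R + rsubmx w 0 k * (i == j)%:R
     - rsubmx w 0 i * (j == k)%:R)).
Proof.
apply/funext => u; rewrite chrE !partial_wdiagSS wdiagS !eq_rshift /cst.
have c0 := lt0r_neq0 (conf_gt0 (rsubmx u)).
by field; rewrite c0 fn0.
Qed.

Lemma partial_cst (k : 'I_(1 + m)) (a : R) u : partial k (cst a) u = 0.
Proof. exact: derive_cst. Qed.

Lemma partialT_TSS i j u : partial T (christoffel g T (S i) (S j)) u =
  - (f1 (tcoord u) ^+ 2 + f (tcoord u) * f2 (tcoord u)) *
  conf (rsubmx u) ^+ 2 * (i == j)%:R.
Proof.
rewrite chr_TSS.
have hp : is_derive (tcoord u) 1 (fun t => - f t * f1 t)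
    (- (f1 (tcoord u) ^+ 2 + f (tcoord u) * f2 (tcoord u))).
  apply: is_derive_eq (is_deriveM (is_deriveN (df _)) (df1 _)) _.
  by rewrite !fctE /GRing.scale/=; ring.
have hc := has_grad_conf (rsubmx u).
have hq := has_gradM (has_gradM hc hc) (has_grad_cst (i == j)%:R _).
have [_ e] := has_grad_splitM hp hq.
by apply: etrans (e T) _; rewrite (unsplitK (inl _)) mulrA.
Qed.

Let dlogf u : is_derive (tcoord u) 1 (fun t => f1 t / f t)
  (f2 (tcoord u) / f (tcoord u) - f1 (tcoord u) ^+ 2 / f (tcoord u) ^+ 2).
Proof.
have f0 := fn0 (tcoord u).
have [dft eft] := df (tcoord u).
have dV : is_derive (tcoord u) 1 (fun t => (f t)^-1)
    (- f (tcoord u) ^- 2 *: f1 (tcoord u)).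
  by apply: DeriveDef; [exact: derivableV | rewrite deriveV// eft].
apply: is_derive_eq (is_deriveM (df1 _) dV) _.
by rewrite /GRing.scale/=; field.
Qed.

Lemma partialT_SST i j u : partial T (christoffel g (S i) (S j) T) u =
  (f2 (tcoord u) / f (tcoord u) - f1 (tcoord u) ^+ 2 / f (tcoord u) ^+ 2) *
  (i == j)%:R.
Proof.
rewrite chr_SST; have [_ ->] := has_grad_splitM (dlogf u) (has_grad_cst (i == j)%:R (rsubmx u)).
by rewrite (unsplitK (inl _)).
Qed.

Lemma partialS_STS a i j u : partial (S a) (christoffel g (S i) T (S j)) u = 0.
Proof.
rewrite chr_STS; have [_ ->] := has_grad_splitM (dlogf u) (has_grad_cst (i == j)%:R (rsubmx u)).
by rewrite (unsplitK (inr _)) mulr0.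
Qed.

Lemma partialS_SST a i j u : partial (S a) (christoffel g (S i) (S j) T) u = 0.
Proof.
rewrite chr_SST; have [_ ->] := has_grad_splitM (dlogf u) (has_grad_cst (i == j)%:R (rsubmx u)).
by rewrite (unsplitK (inr _)) mulr0.
Qed.

Lemma has_grad_SSS i j k u : has_grad (christoffel g (S i) (S j) (S k)) u
  (fun l => match fintype.split l with
    | inl _ => 0
    | inr a => conf (rsubmx u) ^+ 2 * rsubmx u 0 a *
       (rsubmx u 0 j * (i == k)%:R + rsubmx u 0 k * (i == j)%:R
        - rsubmx u 0 i * (j == k)%:R)
       - conf (rsubmx u) *
       ((a == j)%:R * (i == k)%:R + (a == k)%:R * (i == j)%:R
        - (a == i)%:R * (j == k)%:R)
    end).
Proof.
have hc := has_grad_conf (rsubmx u).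
have hd l e : has_grad (fun y => y 0 l * cst e y) (rsubmx u)
    (fun a => (a == l)%:R * e : R).
  apply: has_grad_ext (has_gradM (has_grad_coord _ l) (has_grad_cst e _)) => a.
  by rewrite mulr0 addr0.
have hn q d : has_grad q (rsubmx u) d ->
    has_grad (fun y => cst (- 1) y * q y) (rsubmx u) (fun a => - d a).
  move=> h; apply: has_grad_ext (has_gradM (has_grad_cst _ _) h) => a.
  by rewrite mul0r add0r mulN1r.
have h1 : is_derive (tcoord u) 1 (cst 1 : R -> R) 0 by exact: is_derive_cst.
have := has_grad_splitM h1 (has_gradM (hn _ _ hc)
  (has_gradD (has_gradD (hd j (i == k)%:R) (hd k (i == j)%:R))
             (hn _ _ (hd i (j == k)%:R)))).
move=> H; apply: has_grad_ext (has_grad_near _ H).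
  by move=> l; case: fintype.split => a; rewrite /cst ?mul0r//; ring.
by apply: (@filterE _ (nbhs u)) => w; rewrite chr_SSS /cst !mulN1r.
Qed.

Lemma partialT_SSS i j k u :
  partial T (christoffel g (S i) (S j) (S k)) u = 0.
Proof. by have [_ ->] := has_grad_SSS i j k u; rewrite (unsplitK (inl _)). Qed.

Lemma partialS_SSS a i j k u :
  partial (S a) (christoffel g (S i) (S j) (S k)) u =
  conf (rsubmx u) ^+ 2 * rsubmx u 0 a *
       (rsubmx u 0 j * (i == k)%:R + rsubmx u 0 k * (i == j)%:R
        - rsubmx u 0 i * (j == k)%:R)
       - conf (rsubmx u) *
       ((a == j)%:R * (i == k)%:R + (a == k)%:R * (i == j)%:R
        - (a == i)%:R * (j == k)%:R).
Proof. by have [_ ->] := has_grad_SSS i j k u; rewrite (unsplitK (inr _)). Qed.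

End WarpedMetric.

(** * The Ricci tensor of the warped product *)

Section WarpedRicci.
Context (R : realType) (m : nat) (f f1 f2 : R -> R) (b : bool).
Hypothesis fn0 : forall t, f t != 0.
Hypothesis df : forall t : R, is_derive t 1 f (f1 t).
Hypothesis df1 : forall t : R, is_derive t 1 f1 (f2 t).
Implicit Types (u : 'rV[R]_(1 + m)).

Local Notation g := (@warped_metric R m f b).
Local Notation T := (lshift m (0 : 'I_1)).
Local Notation S := (@rshift 1 m).
Local Notation G := (christoffel g).
(* Unification would otherwise unfold the Christoffel symbols in order to
   compare distinct indices. *)
Opaque lshift rshift christoffel partial.

(** Every contraction is separated into its t index and its sphere indices, since the formula for a
    symbol depends on which of its indices is t. *)
Lemma ricci_split u j k : ricci g u j k =
  partial T (G T j k) u - partial j (G T T k) u +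
  \sum_a (partial (S a) (G (S a) j k) u - partial j (G (S a) (S a) k) u) +
  (G T T T u * G T j k u - G T j T u * G T T k u +
   \sum_d (G T T (S d) u * G (S d) j k u - G T j (S d) u * G (S d) T k u) +
   \sum_a (G (S a) (S a) T u * G T j k u - G (S a) j T u * G T (S a) k u +
     \sum_d (G (S a) (S a) (S d) u * G (S d) j k u
             - G (S a) j (S d) u * G (S d) (S a) k u))).
Proof.
rewrite mxE !big_split_ord/= !big_ord1.
congr (_ + (_ + _)); rewrite ?big_split_ord ?big_ord1//.
by apply: eq_bigr => a _; rewrite big_split_ord big_ord1.
Qed.

Section Point.
Variable u : 'rV[R]_(1 + m).
Local Notation t := (tcoord u).
Local Notation y := (rsubmx u).
Local Notation c := (conf (rsubmx u)).
Local Notation h := (f1 t / f t).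
Local Notation dh := (f2 t / f t - f1 t ^+ 2 / f t ^+ 2).

Let vTT k : G T T k u = 0.
Proof. by rewrite chr_TT. Qed.
Let vTkT k : G T k T u = 0.
Proof. by rewrite chr_TkT. Qed.
Let vSTT i : G (S i) T T u = 0.
Proof. by rewrite chr_STT. Qed.
Let vTSS i j : G T (S i) (S j) u = - f t * f1 t * (c ^+ 2 * (i == j)%:R).
Proof. by rewrite (chr_TSS b fn0 df). Qed.
Let vSTS i j : G (S i) T (S j) u = h * (i == j)%:R.
Proof. by rewrite (chr_STS b fn0 df). Qed.
Let vSST i j : G (S i) (S j) T u = h * (i == j)%:R.
Proof. by rewrite (chr_SST b fn0 df). Qed.
Let vSSS i j k : G (S i) (S j) (S k) u = - c *
  (y 0 j * (i == k)%:R + y 0 k * (i == j)%:R - y 0 i * (j == k)%:R).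
Proof. by rewrite (chr_SSS b fn0 df) mul1r. Qed.

Let pTT i k : partial i (G T T k) u = 0.
Proof. by rewrite chr_TT// partial_cst. Qed.
Let pTkT i k : partial i (G T k T) u = 0.
Proof. by rewrite chr_TkT// partial_cst. Qed.
Let pSTT i k : partial k (G (S i) T T) u = 0.
Proof. by rewrite chr_STT// partial_cst. Qed.
Let pTSS := @partialT_TSS R m _ _ _ b fn0 df df1.
Let pSST := @partialT_SST R m _ _ _ b fn0 df df1.
Let pSSTS := @partialS_STS R m f f1 f2 b fn0 df df1.
Let pSSST := @partialS_SST R m _ _ _ b fn0 df df1.
Let pTSSS := @partialT_SSS R m _ _ b fn0 df.
Let pSSSS := @partialS_SSS R m _ _ b fn0 df.

(** Each of the m sphere directions contributes - (h' + h^2) with h = f'/f, and h' + h^2 = f''/f. *)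
Lemma ricci_TT : ricci g u T T = - m%:R * (f2 t / f t).
Proof.
have E1 a : partial (S a) (G (S a) T T) u - partial T (G (S a) (S a) T) u = - dh.
  by rewrite pSTT pSST eqxx mulr1 sub0r.
have E2 d : G T T (S d) u * G (S d) T T u - G T T (S d) u * G (S d) T T u = 0.
  by rewrite subrr.
have E3 a : (G (S a) (S a) T u * G T T T u - G (S a) T T u * G T (S a) T u +
   \sum_d (G (S a) (S a) (S d) u * G (S d) T T u
           - G (S a) T (S d) u * G (S d) (S a) T u)) = - h ^+ 2.
  rewrite vTT vTkT !mulr0 subrr add0r.
  transitivity (\sum_d - (h ^+ 2 * (a == d)%:R) * (a == d)%:R).
    by apply: eq_bigr => d _; rewrite vSTT vSTS vSST (eq_sym d); ring.
  by rewrite sum_delta eqxx mulr1.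
rewrite ricci_split !pTT subrr add0r (eq_bigr _ (fun a _ => E1 a)).
rewrite (eq_bigr _ (fun a _ => E2 a)) (eq_bigr _ (fun a _ => E3 a)).
rewrite big1_eq !sumr_const card_ord vTT.
rewrite -[(- dh) *+ m]mulr_natl -[(- h ^+ 2) *+ m]mulr_natl.
have f0 := fn0 t.
by field.
Qed.

(** The symbols with one lower index t and two sphere indices are h times a Kronecker delta, so for
    each a both sums over d reduce to h times the symbol with indices a, a, k and cancel. *)
Lemma ricci_TS k : ricci g u T (S k) = 0.
Proof.
have E1 a : partial (S a) (G (S a) T (S k)) u
    - partial T (G (S a) (S a) (S k)) u = 0.
  by rewrite pSSTS pTSSS subrr.
have E2 d : G T T (S d) u * G (S d) T (S k) u
    - G T T (S d) u * G (S d) T (S k) u = 0.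
  by rewrite subrr.
have E3 a : (G (S a) (S a) T u * G T T (S k) u - G (S a) T T u * G T (S a) (S k) u +
   \sum_d (G (S a) (S a) (S d) u * G (S d) T (S k) u
           - G (S a) T (S d) u * G (S d) (S a) (S k) u)) = 0.
  rewrite vTT vSTT mulr0 mul0r subrr add0r sumrB.
  under eq_bigr => d _ do rewrite vSTS mulrA (eq_sym d).
  under [X in _ - X]eq_bigr => d _ do rewrite vSTS mulrAC.
  rewrite !sum_delta !vSSS !eqxx; ring.
rewrite ricci_split !pTT subrr add0r (eq_bigr _ (fun a _ => E1 a)).
rewrite (eq_bigr _ (fun a _ => E2 a)) (eq_bigr _ (fun a _ => E3 a)).
by rewrite !big1_eq vTT mul0r subrr !addr0.
Qed.

Lemma ricci_ST j : ricci g u (S j) T = 0.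
Proof.
have E1 a : partial (S a) (G (S a) (S j) T) u
    - partial (S j) (G (S a) (S a) T) u = 0.
  by rewrite !pSSST subrr.
have E2 d : G T T (S d) u * G (S d) (S j) T u
    - G T (S j) (S d) u * G (S d) T T u = 0.
  by rewrite vTT vSTT mul0r mulr0 subrr.
have E3 a : (G (S a) (S a) T u * G T (S j) T u - G (S a) (S j) T u * G T (S a) T u +
   \sum_d (G (S a) (S a) (S d) u * G (S d) (S j) T u
           - G (S a) (S j) (S d) u * G (S d) (S a) T u)) = 0.
  rewrite !vTkT !mulr0 subrr add0r sumrB.
  under eq_bigr => d _ do rewrite vSST mulrA (eq_sym d).
  under [X in _ - X]eq_bigr => d _ do rewrite vSST mulrA (eq_sym d).
  rewrite !sum_delta !vSSS !eqxx (eq_sym j); ring.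
rewrite ricci_split.
rewrite pTkT.
rewrite pTT.
rewrite subrr add0r.
rewrite (eq_bigr _ (fun a _ => E1 a)).
rewrite (eq_bigr _ (fun a _ => E2 a)) (eq_bigr _ (fun a _ => E3 a)).
by rewrite !big1_eq vTT vTkT !mul0r subrr !addr0.
Qed.

(** Up to the factor c^2, this is the contraction over d of the product of two sphere symbols in the
    Ricci tensor, at fixed a. Only the first factor is expanded: its deltas already collapse the
    sum, except for the term in y_d. *)
Let sum_chr j k a :
  \sum_d (y 0 j * (a == d)%:R + y 0 d * (a == j)%:R - y 0 a * (j == d)%:R) *
    (y 0 a * (k == d)%:R + y 0 k * (a == d)%:R - y 0 d * (a == k)%:R) =
  y 0 j * y 0 k + (a == j)%:R * (2 * y 0 a * y 0 k - (a == k)%:R * normsq y)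
  - y 0 a * (y 0 a * (j == k)%:R + y 0 k * (a == j)%:R - y 0 j * (a == k)%:R).
Proof.
pose X d := y 0 a * (k == d)%:R + y 0 k * (a == d)%:R - y 0 d * (a == k)%:R.
transitivity (\sum_d y 0 j * X d * (a == d)%:R +
  (a == j)%:R * (\sum_d y 0 d * y 0 a * (k == d)%:R
   + \sum_d y 0 d * y 0 k * (a == d)%:R - (a == k)%:R * \sum_d y 0 d * y 0 d)
  - \sum_d y 0 a * X d * (j == d)%:R).
  rewrite mulr_sumr -big_split -sumrB mulr_sumr -big_split -sumrB.
  by apply: eq_bigr => d _; rewrite /X /=; ring.
rewrite !sum_delta -normsqE /X (eq_sym k a) (eq_sym k j) eqxx mulr1.
by ring.
Qed.

(** The products y_j y_k cancel between the derivatives in [E1] and the quadratic terms in [E3]. The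
    remaining terms without f add up to (m - 1) c (2 - c |y|^2), which is (m - 1) c^2, the Ricci
    tensor of the unit sphere. *)
Lemma ricci_SS j k : ricci g u (S j) (S k) =
  ((m%:R - 1) * (1 - f1 t ^+ 2) - f t * f2 t) * c ^+ 2 * (j == k)%:R.
Proof.
have E1 : \sum_a (partial (S a) (G (S a) (S j) (S k)) u
    - partial (S j) (G (S a) (S a) (S k)) u) =
    (2 - m%:R) * (c ^+ 2 * y 0 j * y 0 k - c * (j == k)%:R)
    - (c ^+ 2 * normsq y - m%:R * c) * (j == k)%:R.
  (* Terms are sorted by their dependence on a, so that every sum is a contraction with a delta, the
     squared norm, or the number m. *)
  transitivity (\sum_a c ^+ 2 * y 0 a * y 0 j * (k == a)%:R
    + \sum_a c ^+ 2 * y 0 a * y 0 k * (j == a)%:R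
    - c ^+ 2 * (j == k)%:R * \sum_a y 0 a * y 0 a
    - 2 * c * \sum_a (k == a)%:R * (j == a)%:R
    + (2 * c * (j == k)%:R - c ^+ 2 * y 0 j * y 0 k) * \sum_(a < m) 1).
    rewrite !mulr_sumr -!(big_split, sumrB)/=; apply: eq_bigr => a _.
    by rewrite !pSSSS !eqxx !mulr1 ?mul1r (eq_sym k) (eq_sym j a); ring.
  by rewrite !sum_delta -normsqE sumr_const card_ord (eq_sym k); ring.
have E2 : \sum_d (G T T (S d) u * G (S d) (S j) (S k) u
    - G T (S j) (S d) u * G (S d) T (S k) u) = f1 t ^+ 2 * c ^+ 2 * (j == k)%:R.
  transitivity (\sum_d f1 t ^+ 2 * c ^+ 2 * (j == d)%:R * (k == d)%:R).
    apply: eq_bigr => d _; rewrite vTT mul0r sub0r vTSS vSTS (eq_sym d).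
    have f0 := fn0 t; by field.
  by rewrite sum_delta.
have E3 : \sum_a (G (S a) (S a) T u * G T (S j) (S k) u
     - G (S a) (S j) T u * G T (S a) (S k) u +
     \sum_d (G (S a) (S a) (S d) u * G (S d) (S j) (S k) u
             - G (S a) (S j) (S d) u * G (S d) (S a) (S k) u)) =
   - m%:R * f1 t ^+ 2 * c ^+ 2 * (j == k)%:R + f1 t ^+ 2 * c ^+ 2 * (j == k)%:R
   + c ^+ 2 * (m%:R * (2 * y 0 j * y 0 k - normsq y * (j == k)%:R)
     - (m%:R + 2) * y 0 j * y 0 k + 2 * normsq y * (j == k)%:R).
  have E a : G (S a) (S a) T u * G T (S j) (S k) u
     - G (S a) (S j) T u * G T (S a) (S k) u +
     \sum_d (G (S a) (S a) (S d) u * G (S d) (S j) (S k) u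
             - G (S a) (S j) (S d) u * G (S d) (S a) (S k) u) =
     - f1 t ^+ 2 * c ^+ 2 * (j == k)%:R
     + f1 t ^+ 2 * c ^+ 2 * (k == a)%:R * (j == a)%:R
     + c ^+ 2 * (2 * y 0 j * y 0 k - normsq y * (j == k)%:R)
     - c ^+ 2 * (y 0 j * y 0 k
       + (a == j)%:R * (2 * y 0 a * y 0 k - (a == k)%:R * normsq y)
       - y 0 a * (y 0 a * (j == k)%:R + y 0 k * (a == j)%:R
                  - y 0 j * (a == k)%:R)).
    rewrite -sum_chr sumrB addrA; congr (_ + _); last first.
      rewrite mulr_sumr; congr (- _); apply: eq_bigr => d _.
      by rewrite !vSSS (eq_sym k) (eq_sym d a); ring.
    have -> : \sum_d G (S a) (S a) (S d) u * G (S d) (S j) (S k) u =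
        c ^+ 2 * (\sum_d y 0 d * y 0 j * (k == d)%:R
        + \sum_d y 0 d * y 0 k * (j == d)%:R
        - (j == k)%:R * \sum_d y 0 d * y 0 d).
      rewrite [(j == k)%:R * _]mulr_sumr -big_split -sumrB mulr_sumr.
      apply: eq_bigr => d _ /=.
      by rewrite !vSSS !eqxx !mulr1 ?mul1r (eq_sym k) (eq_sym j d); ring.
    rewrite !sum_delta -normsqE !vTSS !vSST eqxx mulr1 (eq_sym k a) (eq_sym j a).
    by have f0 := fn0 t; field.
  rewrite (eq_bigr _ (fun a _ => E a)).
  transitivity ((- f1 t ^+ 2 * c ^+ 2 * (j == k)%:R
      + c ^+ 2 * (2 * y 0 j * y 0 k - normsq y * (j == k)%:R)
      - c ^+ 2 * y 0 j * y 0 k) * (\sum_(a < m) 1)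
    + (f1 t ^+ 2 * c ^+ 2 + c ^+ 2 * normsq y)
      * \sum_a (k == a)%:R * (j == a)%:R
    - c ^+ 2 * (\sum_a y 0 a * y 0 k * (j == a)%:R)
    - c ^+ 2 * (\sum_a y 0 a * y 0 j * (k == a)%:R)
    + c ^+ 2 * (j == k)%:R * \sum_a y 0 a * y 0 a).
    rewrite !mulr_sumr -!(big_split, sumrB)/=; apply: eq_bigr => a _.
    by rewrite (eq_sym k a) (eq_sym j a); ring.
  by rewrite !sum_delta -normsqE sumr_const card_ord (eq_sym k); ring.
rewrite ricci_split (pTT (S j) (S k)) (pTSS j k) (vTT T) (vTT (S k)) E1 E2 E3.
have -> : normsq y = 2 / c - 1.
  by rewrite /conf; field; rewrite lt0r_neq0// normsq1_gt0.
have c0 := lt0r_neq0 (conf_gt0 y).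
by field.
Qed.

End Point.
End WarpedRicci.

(** * Diagonal matrices; attained infima and suprema *)

Section DiagonalMatrix.
Context (R : realType) (n : nat) (A : 'M[R]_n) (d : 'I_n -> R).
Hypothesis Ad : forall i j, A i j = d i * (i == j)%:R.

Lemma mulmx_diagonal (v : 'rV[R]_n) j : (v *m A) 0 j = v 0 j * d j.
Proof.
rewrite mxE (bigD1 j)//= Ad eqxx mulr1 big1 ?addr0// => i ij.
by rewrite Ad (negbTE ij) !mulr0.
Qed.

Lemma posdef_diagonal : (forall i, 0 < d i) -> posdef A.
Proof.
move=> d0 v v0; rewrite mxE.
have E j : (v *m A) 0 j * v^T j 0 = d j * v 0 j ^+ 2.
  by rewrite mulmx_diagonal mxE; ring.
rewrite (eq_bigr _ (fun j _ => E j)).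
have [j vj] : exists j, v 0 j != 0 by apply/rV0Pn.
rewrite (bigD1 j)//= ltr_pwDl//.
  by rewrite mulr_gt0// exprn_even_gt0//= vj.
by apply: sumr_ge0 => i _; rewrite mulr_ge0 ?sqr_ge0// ltW.
Qed.

Lemma eigenvalue_diagonal l : eigenvalue A l <-> exists i, l = d i.
Proof.
split=> [/eigenvalueP[v vA v0]|[i ->]].
  have [j vj] : exists j, v 0 j != 0 by apply/rV0Pn.
  exists j; apply: (mulfI vj); rewrite -mulmx_diagonal vA mxE; exact: mulrC.
apply/eigenvalueP; exists (delta_mx 0 i).
  apply/rowP => j; rewrite mulmx_diagonal !mxE eqxx/=.
  by have [->|] := eqVneq j i; rewrite ?mul1r ?mulr1// mul0r mulr0.
by apply/rV0Pn; exists i; rewrite mxE !eqxx oner_neq0.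
Qed.

End DiagonalMatrix.

Lemma inf_minimum (R : realType) (E : set R) x : E x -> lbound E x -> inf E = x.
Proof.
move=> Ex lbx; apply/eqP; rewrite eq_le; apply/andP; split.
  by apply: ge_inf => //; exists x.
by apply: lb_le_inf => //; exists x.
Qed.

Lemma sup_maximum (R : realType) (E : set R) x : E x -> ubound E x -> sup E = x.
Proof.
move=> Ex ubx; apply/eqP; rewrite eq_le; apply/andP; split.
  by apply: ge_sup => //; exists x.
by apply: ub_le_sup => //; exists x.
Qed.

(** * Ricci eigenvalues and the pinching constant *)

Section Pinching.
Context (R : realType) (m : nat) (a delta : R).
Hypothesis m2 : (2 <= m)%N.
Hypothesis delta_gt0 : 0 < delta.
Hypothesis delta_lt : delta < 1 / m%:R.
Hypothesis aE : a = m%:R * (1 - delta) / (1 - m%:R * delta).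
Local Notation f := (fun t : R => a - cos t).

Let m0 : (2 : R) <= m%:R.
Proof. by rewrite ler_nat. Qed.

Let md : m%:R * delta < 1.
Proof. by rewrite mulrC -ltr_pdivlMr//; have := m0; lra. Qed.

Let a_eq : a * (1 - m%:R * delta) = m%:R * (1 - delta).
Proof. by rewrite aE divfK// gt_eqF//; have := md; lra. Qed.

Lemma pinching_radius_gt : m%:R < a.
Proof.
rewrite aE ltr_pdivlMr; last by have := md; lra.
(* This is the numerator of a - m, namely m (1 - delta) - m (1 - m delta). *)
have h : 0 < m%:R * (m%:R - 1) * delta.
  by rewrite mulr_gt0// mulr_gt0//; have := m0; lra.
rewrite -subr_gt0; apply: lt_le_trans h _; rewrite le_eqVlt; apply/orP; left.
by apply/eqP; ring.
Qed.

Lemma pinching_f_gt0 x : x <= 1 -> 0 < a - x.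
Proof. by have := pinching_radius_gt; have := m0; lra. Qed.

Lemma pinching_mf_gt0 x : x <= 1 -> 0 < a - m%:R * x.
Proof.
move=> x1; have := pinching_radius_gt; have := m0 => h1 h2.
have : m%:R * x <= m%:R * 1 by rewrite ler_wpM2l//; lra.
lra.
Qed.

Lemma f_neq0 t : f t != 0.
Proof. by rewrite gt_eqF// pinching_f_gt0// cos_le1. Qed.

Lemma is_derive_f (t : R) : is_derive t 1 f (sin t).
Proof.
apply: is_derive_eq (is_deriveB (is_derive_cst (a : R) t (1 : R)) (is_derive_cos t)) _.
by rewrite sub0r opprK.
Qed.

Definition ric1 x : R := - (m%:R * x / (a - x)).
Definition ric2 x : R := - (x * (a - m%:R * x) / (a - x) ^+ 2).

Section Point.
Variables (b : bool) (u : 'rV[R]_(1 + m)).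
Local Notation g := (@warped_metric R m f b).
Local Notation x := (cos (tcoord u)).

Definition ric_diag (k1 k2 : R) (i : 'I_(1 + m)) : R :=
  if fintype.split i is inl _ then k1 else k2.

(** The sphere entry is the eigenvalue [ric2 x] times the corresponding entry of the metric. The
    identity 1 - sin^2 = cos^2 is what allows x to be factored out of it. *)
Lemma ricci_diag i j : ricci g u i j =
  ric_diag (ric1 x) (ric2 x * (a - x) ^+ 2 * conf (rsubmx u) ^+ 2) i
  * (i == j)%:R.
Proof.
have h := ricci_SS b f_neq0 is_derive_f (@is_derive_sin R).
rewrite /ric_diag /ric1 /ric2.
case: (split_ordP i) => i' ->; case: (split_ordP j) => j' ->; rewrite ?ord1.
- rewrite (ricci_TT b f_neq0 is_derive_f (@is_derive_sin R)) eqxx.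
  by rewrite mulr1 mulrA mulNr mulNr.
- by rewrite (ricci_TS b f_neq0 is_derive_f (@is_derive_sin R)) eq_lrshift mulr0.
- by rewrite (ricci_ST b f_neq0 is_derive_f (@is_derive_sin R)) eq_rlshift mulr0.
- rewrite h eq_rshift -cos2sin2; have := f_neq0 (tcoord u) => /= f0.
  by congr (_ * _); field.
Qed.

Lemma ricci_endo_diag i j : (ricci g u *m invmx (g u)) i j =
  ric_diag (ric1 x) (ric2 x) i * (i == j)%:R.
Proof.
have inv := invmx_diag (warped_diag f b) _ _ (wdiag_neq0 f_neq0 u).
rewrite mxE (bigD1 i)//= big1 ?addr0; last first.
  by move=> k ki; rewrite ricci_diag eq_sym (negbTE ki) mulr0 mul0r.
rewrite ricci_diag inv eqxx mulr1 mulrA; congr (_ * _).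
rewrite /ric_diag /wdiag; case: fintype.split => _; first by rewrite invr1 mulr1.
have c0 := lt0r_neq0 (conf_gt0 (rsubmx u)).
have := f_neq0 (tcoord u) => /= f0.
by rewrite invfM -mulrA; field; rewrite f0 c0.
Qed.

End Point.

Section WarpedAtlas.
Variables (M : atlas R (1 + m)) (X : M -> R) (pole : chart M -> bool).
Hypothesis cover : forall p : M, exists c u, dom c u /\ param c u = p.
Hypothesis tensorE : forall c : chart M, tensor c = @warped_metric R m f (pole c).
Hypothesis XE : forall (c : chart M) u, dom c u -> X (param c u) = cos (tcoord u).
Hypothesis X1 : exists p : M, X p = 1.
Hypothesis XN1 : exists p : M, X p = -1.

Let Xle1 p : X p <= 1.
Proof. by have [c [u [cu <-]]] := cover p; rewrite (XE cu) cos_le1. Qed.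

Lemma atlas_ricci_flat p : X p = 0 -> ricci_flat p.
Proof.
move=> Xp c u cu up; apply/matrixP => i j.
rewrite tensorE ricci_diag -(XE cu) up Xp [RHS]mxE /ric_diag /ric1 /ric2.
by case: fintype.split => _; rewrite ?mulr0 ?mul0r oppr0 ?mul0r.
Qed.

Lemma atlas_ricci_pos p : X p < 0 -> ricci_pos p.
Proof.
move=> Xp c u cu up; rewrite tensorE.
apply: (posdef_diagonal (ricci_diag (pole c) u)).
rewrite -(XE cu) up => i; rewrite /ric_diag /ric1 /ric2.
have f0 := pinching_f_gt0 (Xle1 p); have mf0 := pinching_mf_gt0 (Xle1 p).
have := m0 => mm; have c0 := conf_gt0 (rsubmx u).
case: fintype.split => _.
  rewrite oppr_gt0 pmulr_llt0 ?invr_gt0// pmulr_rlt0//; lra.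
rewrite mulr_gt0 ?exprn_gt0// mulr_gt0 ?exprn_gt0// oppr_gt0.
by rewrite pmulr_llt0 ?invr_gt0 ?exprn_gt0// pmulr_llt0.
Qed.

Lemma atlas_ricci_neg p : 0 < X p -> ricci_neg p.
Proof.
move=> Xp c u cu up; rewrite tensorE.
apply: (posdef_diagonal (d := fun i => - ric_diag (ric1 (X p))
  (ric2 (X p) * (a - X p) ^+ 2 * conf (rsubmx u) ^+ 2) i)).
  move=> i j; have oppE (A : 'M[R]_(1 + m)) : (- A) i j = - A i j by rewrite mxE.
  by rewrite oppE ricci_diag -(XE cu) up -mulNr.
move=> i; rewrite /ric_diag /ric1 /ric2.
have f0 := pinching_f_gt0 (Xle1 p); have mf0 := pinching_mf_gt0 (Xle1 p).
have := m0 => mm; have c0 := conf_gt0 (rsubmx u).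
case: fintype.split => _.
  by rewrite opprK divr_gt0// mulr_gt0//; lra.
rewrite -mulNr -mulNr opprK mulr_gt0 ?exprn_gt0// mulr_gt0 ?exprn_gt0//.
by rewrite divr_gt0 ?exprn_gt0// mulr_gt0.
Qed.

Lemma atlas_ricci_eigenvalues p l :
  ricci_eigenvalues p l <-> l = ric1 (X p) \/ l = ric2 (X p).
Proof.
have endo := eigenvalue_diagonal (ricci_endo_diag _ _).
split.
  move=> [c [u [cu up]]]; rewrite tensorE => /endo[i ->].
  by rewrite /ric_diag -(XE cu) up; case: fintype.split => _; [left|right].
have [c [u [cu up]]] := cover p.
move=> h; exists c, u; split=> //; rewrite tensorE; apply/endo.
(* A sphere index has to exist for [ric2] to occur as an eigenvalue. *)
have mpos : (0 < m)%N by exact: leq_trans m2.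
case: h => ->; rewrite -up (XE cu).
  by exists (lshift m 0); rewrite /ric_diag (unsplitK (inl _)).
by exists (rshift 1 (Ordinal mpos)); rewrite /ric_diag (unsplitK (inr _)).
Qed.

Lemma ric_ratio x : x <= 1 -> x != 0 ->
  `|ric2 x| / `|ric1 x| = (a - m%:R * x) / (m%:R * (a - x)).
Proof.
move=> x1 x0; rewrite /ric1 /ric2 !normrN !normrM !normfV normrX.
have f0 := pinching_f_gt0 x1; have mf0 := pinching_mf_gt0 x1.
have := m0 => mm.
rewrite (gtr0_norm f0) (gtr0_norm mf0) normr_nat.
by field; rewrite normr_eq0 x0 !gt_eqF//; lra.
Qed.

(** After clearing denominators and the factor |x|, the claim is a - m x <= m (a - x), that is, a <=
    m a. *)
Lemma ric2_le_ric1 x : -1 <= x <= 1 -> `|ric2 x| <= `|ric1 x|.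
Proof.
move=> /andP[xN1 x1]; have f0 := pinching_f_gt0 x1.
have := m0 => mm; have mf0 := pinching_mf_gt0 x1.
rewrite /ric1 /ric2 !normrN !normrM !normfV normrX.
rewrite (gtr0_norm f0) (gtr0_norm mf0) normr_nat.
rewrite ler_pdivrMr ?exprn_gt0// expr2 mulrA divfK ?gt_eqF//.
rewrite [_ * `|x|]mulrC -mulrA ler_wpM2l//.
have := pinching_radius_gt; nra.
Qed.

Lemma atlas_delta_ric p : X p != 0 ->
  delta_ric p = (a - m%:R * X p) / (m%:R * (a - X p)).
Proof.
move=> Xp0; rewrite -ric_ratio// /delta_ric.
have Xb : -1 <= X p <= 1.
  by have [c [u [cu <-]]] := cover p; rewrite (XE cu) cos_geN1 cos_le1.
have le := ric2_le_ric1 Xb.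
rewrite (@inf_minimum _ _ `|ric2 (X p)|); first 1 last.
- by exists (ric2 (X p)) => //; apply/atlas_ricci_eigenvalues; right.
- by move=> _ [l /atlas_ricci_eigenvalues[->|->] <-].
rewrite (@sup_maximum _ _ `|ric1 (X p)|)//.
- by exists (ric1 (X p)) => //; apply/atlas_ricci_eigenvalues; left.
- by move=> _ [l /atlas_ricci_eigenvalues[->|->] <-].
Qed.

Lemma atlas_pinched : sharply_ricci_pinched M delta.
Proof.
have := m0 => mm.
have ge (p : M) : ~ ricci_flat p -> delta <= delta_ric p.
  move=> nf; have [/atlas_ricci_flat//|Xp0] := eqVneq (X p) 0.
  have f0 := pinching_f_gt0 (Xle1 p).
  rewrite atlas_delta_ric// ler_pdivlMr ?mulr_gt0//; last lra.
  rewrite -subr_ge0.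
  (* By the equation that defines a, this difference is m (1 - delta) (1 - X p), which vanishes
     where X p = 1. *)
  rewrite (_ : _ - _ = a * (1 - m%:R * delta)
    - m%:R * (1 - delta) * X p); last by ring.
  rewrite a_eq -[X in X - _]mulr1 -mulrBr.
  have d1 : delta <= 1 by have := md; nra.
  by rewrite mulr_ge0 ?subr_ge0// mulr_ge0 ?subr_ge0//; lra.
have [q Xq] := X1.
have q0 : X q != 0 by rewrite Xq oner_neq0.
have nq : ~ ricci_flat q.
  have [c [u [cu up]]] := cover q.
  (* The entry in the t direction is - m / (a - 1), which is not zero. *)
  move=> /(_ c u cu up)/matrixP/(_ (lshift m 0) (lshift m 0)).
  rewrite tensorE ricci_diag eqxx mulr1 mxE /ric_diag (unsplitK (inl _)).
  rewrite -(XE cu) up Xq /ric1 mulr1 => /eqP; rewrite oppr_eq0 mulf_eq0 invr_eq0.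
  by rewrite !gt_eqF//; [exact: pinching_f_gt0|lra].
have dq : delta_ric q = delta.
  rewrite atlas_delta_ric// Xq !mulr1.
  have f0 : 0 < a - 1 by exact: pinching_f_gt0.
  apply: (mulIf (x := m%:R * (a - 1))).
    by rewrite mulf_neq0 ?gt_eqF//; lra.
  rewrite divfK; last by rewrite mulf_neq0 ?gt_eqF//; lra.
  have := a_eq; lra.
split.
- move=> p; have [|/atlas_ricci_neg|/atlas_ricci_flat] := ltrgtP (X p) 0; last tauto.
  + by move/atlas_ricci_pos; left.
  + tauto.
- by have [p Xp] := XN1; exists p; apply: atlas_ricci_pos; rewrite Xp; lra.
- by exists q; apply: atlas_ricci_neg; rewrite Xq.
- exact: ge.
- by exists q.
(* The point q bounds the admissible constants by delta, and delta is itself admissible, so the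
   supremum is a maximum. *)
- rewrite /pinching_constant (@sup_maximum _ _ delta)// => k.
  by move=> /(_ q nq); rewrite dq.
Qed.

End WarpedAtlas.
End Pinching.

(** * The two stereographic projections and the inversion between them *)

Section Stereographic.
Context (R : realType) (m : nat).
Implicit Types (x : 'rV[R]_(m + 1)) (y : 'rV[R]_m) (b : bool).

(** On the sphere it vanishes only at the pole of projection, and it equals [conf] along [stereo b];
    hence its role as denominator of the inverse. *)
Definition height b x : R := 1 - (-1) ^+ b * x 0 (rshift m 0).

Definition inv_stereo b x : 'rV[R]_m := (height b x)^-1 *: lsubmx x.

Lemma height_stereo b y : height b (stereo b y) = conf y.
Proof. by rewrite /height stereo_rshift; case: b; ring. Qed.

Lemma stereoK b : cancel (@stereo R m b) (inv_stereo b).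
Proof.
move=> y; rewrite /inv_stereo height_stereo; apply/rowP => k.
rewrite [LHS]mxE [X in _ * X]mxE stereo_lshift mulKf//.
by rewrite gt_eqF// conf_gt0.
Qed.

Lemma sphereE x : ((x *m x^T) 0 0 == 1) =
  (normsq (lsubmx x) == 1 - x 0 (rshift m 0) ^+ 2).
Proof.
rewrite mxE big_split_ord big_ord1/= mxE -expr2 eq_sym -subr_eq eq_sym.
congr (_ == _); rewrite normsqE; apply: eq_bigr => k _.
by rewrite !mxE.
Qed.

Lemma normsqZ (k : R) y : normsq (k *: y) = k ^+ 2 * normsq y.
Proof.
by rewrite !normsqE mulr_sumr; apply: eq_bigr => i _; rewrite !mxE; ring.
Qed.

Lemma conf_inv_stereo b x : (x *m x^T) 0 0 == 1 -> height b x != 0 ->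
  conf (inv_stereo b x) = height b x.
Proof.
rewrite sphereE => /eqP nx h0; rewrite /conf normsqZ nx.
(* With h the height, the remaining coordinates have squared norm 1 - (1 - h)^2 = h (2 - h);
   dividing by h^2 gives 2 / h - 1. *)
have -> : x 0 (rshift m 0) ^+ 2 = (1 - height b x) ^+ 2.
  by rewrite /height; case: b {h0}; ring.
rewrite (_ : 1 + _ = 2 / height b x); first by field.
by field.
Qed.

Lemma inv_stereoK b x : (x *m x^T) 0 0 == 1 -> height b x != 0 ->
  stereo b (inv_stereo b x) = x.
Proof.
move=> sx h0; apply/rowP => k; case: (split_ordP k) => j ->.
  by rewrite stereo_lshift conf_inv_stereo// !mxE mulVKf.
rewrite ord1 stereo_rshift conf_inv_stereo// /height.
by case: b {h0}; ring.
Qed.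

Lemma stereo_ptK b y y' : stereo_pt b y = stereo_pt b y' -> y = y'.
Proof. by move=> /(congr1 val)/= /(can_inj (stereoK b)). Qed.

Lemma stereo_pt_cover (x : sphere R m) : exists b y, stereo_pt b y = x.
Proof.
pose z := val x 0 (rshift m 0).
(* The pole is taken on the other side of the equator from x, so that the height is at least 1. *)
exists (0 < z), (inv_stereo (0 < z) (val x)); apply/val_inj/inv_stereoK => /=.
  exact: valP x.
by rewrite /height -/z gt_eqF//; case: (ltP 0 z); lra.
Qed.

Lemma conf_inversion y : 0 < normsq y ->
  conf ((normsq y)^-1 *: y) = normsq y * conf y.
Proof.
move=> s0; rewrite /conf normsqZ; field.
by rewrite !gt_eqF//= ?ltr_pwDl// ?normsq_ge0// addrC ltr_pwDl// ltW.
Qed.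

Lemma stereo_pt_inversion b y : 0 < normsq y ->
  stereo_pt (~~ b) ((normsq y)^-1 *: y) = stereo_pt b y.
Proof.
move=> s0; apply/val_inj/rowP => k /=.
case: (split_ordP k) => j ->.
  rewrite !stereo_lshift conf_inversion// mxE; field.
  by rewrite gt_eqF.
rewrite ord1 !stereo_rshift conf_inversion//.
have n0 := normsq1_gt0 y.
by case: b; rewrite /conf; field; rewrite gt_eqF.
Qed.

Lemma stereo_pt_opposite b y y' : stereo_pt b y = stereo_pt (~~ b) y' ->
  0 < normsq y /\ y' = (normsq y)^-1 *: y.
Proof.
(* The centre y = 0 is sent to the pole of the other projection, which that projection reaches for
   no y' because conf y' > 0. *)
move=> e; have s0 : 0 < normsq y.
  rewrite lt_def normsq_ge0 andbT; apply/eqP => n0.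
  move: e => /(congr1 (fun x : sphere R m => (val x : 'rV_(m + 1)) 0 (rshift m 0))) /=.
  rewrite !stereo_rshift {1}/conf n0 addr0 divr1.
  by have := conf_gt0 y'; case: b => /=; rewrite ?expr0 ?expr1; lra.
split=> //; apply: (@stereo_ptK (~~ b)).
by rewrite -e stereo_pt_inversion.
Qed.

Lemma inversion_grad y k : 0 < normsq y ->
  has_grad (fun w => ((normsq w)^-1 *: w) 0 k) y
    (fun i => (i == k)%:R / normsq y - 2 * y 0 i * y 0 k / normsq y ^+ 2).
Proof.
move=> s0; have n0 := lt0r_neq0 s0.
rewrite (_ : (fun _ => _) = fun w => (normsq w)^-1 * w 0 k); last first.
  by apply/funext => w; rewrite mxE.
apply: has_grad_ext (has_gradM (has_gradV n0 (has_grad_normsq y))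
  (has_grad_coord y k)) => i.
by field.
Qed.

End Stereographic.

(** * Warped products as Riemannian manifolds *)

Section Riemannian.
Context (R : realType) (m : nat) (f : R -> R).
Hypothesis fn0 : forall t, f t != 0.
Hypothesis felem : forall U : set 'rV[R]_(1 + m), elem U (fun u => f (tcoord u)).
Implicit Types (u v w : 'rV[R]_(1 + m)).

Local Notation T := (lshift m (0 : 'I_1)).
Local Notation S := (@rshift 1 m).

Lemma continuous_tcoord : continuous (@tcoord R m).
Proof.
by move=> u; apply: differentiable_continuous; have [] := has_grad_tcoord u.
Qed.

Lemma open_tcoord (D : set R) : open D -> open [set u : 'rV[R]_(1 + m) | D (tcoord u)].
Proof. by move=> oD; apply: open_comp => // u _; exact: continuous_tcoord. Qed.

Lemma open_normsq : open [set u : 'rV[R]_(1 + m) | 0 < normsq (rsubmx u)].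
Proof.
apply: (@open_comp _ _ (fun u : 'rV[R]_(1 + m) => normsq (rsubmx u))
  [set x | 0 < x]); last exact: open_gt.
move=> u _; apply: differentiable_continuous.
by have [] := has_grad_rsubmx (has_grad_normsq (rsubmx u)).
Qed.

Lemma elem_normsq (U : set 'rV[R]_(1 + m)) :
  elem U (fun w => normsq (rsubmx w)).
Proof.
rewrite (_ : (fun _ => _) = fun w => \sum_k w 0 (S k) * w 0 (S k)).
  by apply: elem_sum => k; apply: elemM; exact: elem_coord.
apply/funext => w; rewrite normsqE.
by apply: eq_bigr => k _; rewrite !mxE.
Qed.

Lemma elem_conf (U : set 'rV[R]_(1 + m)) : elem U (fun w => conf (rsubmx w)).
Proof.
apply: (@elemM _ _ _ (cst 2)); first exact: elem_cst.
apply: elemV; first by move=> w _; rewrite gt_eqF// normsq1_gt0.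
by apply: (@elemD _ _ _ (cst 1)); [exact: elem_cst|exact: elem_normsq].
Qed.

Lemma elem_wdiag (U : set 'rV[R]_(1 + m)) i : elem U (wdiag f i).
Proof.
case: (split_ordP i) => k ->.
  rewrite (_ : wdiag _ _ = cst 1); first exact: elem_cst.
  by apply/funext => w; rewrite ord1 wdiagT.
rewrite (_ : wdiag _ _ = fun w => (f (tcoord w) * f (tcoord w)) *
  (conf (rsubmx w) * conf (rsubmx w))); last first.
  by apply/funext => w; rewrite wdiagS !expr2.
by apply: elemM; apply: elemM; rewrite ?felem//; exact: elem_conf.
Qed.

Definition glue (s : R) (sigma : 'rV[R]_m -> 'rV[R]_m) w : 'rV[R]_(1 + m) :=
  row_mx (tcoord w + s)%:M (sigma (rsubmx w)).

Lemma glueT s sigma w : glue s sigma w 0 T = tcoord w + s.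
Proof. by rewrite row_mxEl mxE eqxx mulr1n. Qed.

Lemma glueS s sigma w k : glue s sigma w 0 (S k) = sigma (rsubmx w) 0 k.
Proof. by rewrite row_mxEr. Qed.

Lemma tcoord_glue s sigma w : tcoord (glue s sigma w) = tcoord w + s.
Proof. by rewrite /tcoord row_mxKl mxE eqxx mulr1n. Qed.

Lemma rsubmx_glue s sigma w : rsubmx (glue s sigma w) = sigma (rsubmx w).
Proof. exact: row_mxKr. Qed.

Lemma eq_glue u v s sigma : tcoord v = tcoord u + s ->
  rsubmx v = sigma (rsubmx u) -> glue s sigma u = v.
Proof.
move=> tv yv; rewrite -[v]hsubmxK /glue -yv; congr (row_mx _ _).
by rewrite -tv [RHS]mx11_scalar.
Qed.

(** The Jacobian of [glue s sigma] is block diagonal, so a period s of f and an infinitesimal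
    isometry condition on sigma for the round metric are enough. *)
Lemma glue_isometry s (sigma : 'rV[R]_m -> 'rV[R]_m) u (e : 'I_m -> 'I_m -> R) (b b' : bool) :
  (forall t, f (t + s) = f t) ->
  (forall k, has_grad (fun y => sigma y 0 k) (rsubmx u) (e k)) ->
  (forall i j, conf (sigma (rsubmx u)) ^+ 2 * \sum_k e k i * e k j =
               conf (rsubmx u) ^+ 2 * (i == j)%:R) ->
  warped_metric f b u = 'J (glue s sigma) u *m
    warped_metric f b' (glue s sigma u) *m ('J (glue s sigma) u)^T.
Proof.
move=> fs he iso.
pose d (k i : 'I_(1 + m)) : R :=
  match fintype.split k with
  | inl _ => (i == T)%:R
  | inr a => match fintype.split i with inl _ => 0 | inr c => e a c end
  end.
have dTT : d T T = 1 by rewrite /d (unsplitK (inl _)) eqxx.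
have dTS i : d T (S i) = 0 by rewrite /d (unsplitK (inl _)) eq_rlshift.
have dST k : d (S k) T = 0 by rewrite /d (unsplitK (inr _)) (unsplitK (inl _)).
have dSS k i : d (S k) (S i) = e k i by rewrite /d !(unsplitK (inr _)).
have hd k : has_grad (fun w => glue s sigma w 0 k) u (d k).
  case: (split_ordP k) => j ->.
    rewrite ord1 (_ : (fun _ => _) = fun w => tcoord w + cst s w); last first.
      by apply/funext => w; rewrite glueT.
    apply: has_grad_ext (has_gradD (has_grad_tcoord u) (has_grad_cst s u)) => i.
    by rewrite addr0 /d (unsplitK (inl _)).
  rewrite (_ : (fun _ => _) = fun w => sigma (rsubmx w) 0 j); last first.
    by apply/funext => w; rewrite glueS.
  apply: has_grad_ext (has_grad_rsubmx (he j)) => i.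
  by rewrite /d (unsplitK (inr _)).
apply/matrixP => i j; rewrite [RHS](gram_jacobian _ i j hd).
under eq_bigr => k _.
  under eq_bigr => l _ do rewrite (warped_diag f b') mulrA mulrAC.
  rewrite sum_delta; over.
rewrite (warped_diag f b) big_split_ord big_ord1/= wdiagT.
under eq_bigr do rewrite wdiagS tcoord_glue rsubmx_glue fs.
case: (split_ordP i) => i' ->; case: (split_ordP j) => j' ->; rewrite ?ord1.
- rewrite wdiagT eqxx dTT big1 ?addr0 ?mulr1// => k _.
  by rewrite dST !mul0r.
- rewrite eq_lrshift dTT dTS !mulr0 big1 ?addr0// => k _.
  by rewrite dST !mul0r.
- rewrite eq_rlshift dTT dTS !mulr0 !mul0r big1 ?addr0// => k _.
  by rewrite dST mulr0.
- rewrite eq_rshift !dTS !mul0r add0r wdiagS -mulrA -iso mulrA mulr_sumr.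
  by apply: eq_bigr => k _; rewrite !dSS; ring.
Qed.

Variables (M : atlas R (1 + m)) (pole : chart M -> bool) (D : chart M -> set R).
Hypothesis openD : forall c, open (D c).
Hypothesis domE : forall c : chart M, dom c = [set u | D c (tcoord u)].
Hypothesis tensorE : forall c : chart M, tensor c = @warped_metric R m f (pole c).
Hypothesis cover : forall p : M, exists c u, dom c u /\ param c u = p.
Hypothesis inj : forall (c : chart M) u v, dom c u -> dom c v ->
  param c u = param c v -> tcoord u = tcoord v /\
  stereo_pt (pole c) (rsubmx u) = stereo_pt (pole c) (rsubmx v).
(* The parameters of two charts that meet differ by a period s of f and a
   change of stereographic coordinates. *)
Hypothesis overlap : forall (c c' : chart M) u v, dom c u -> dom c' v ->
  param c u = param c' v -> exists s, [/\ forall t, f (t + s) = f t,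
    tcoord v = tcoord u + s,
    stereo_pt (pole c) (rsubmx u) = stereo_pt (pole c') (rsubmx v)
    & forall w w', tcoord w' = tcoord w + s ->
      stereo_pt (pole c) (rsubmx w) = stereo_pt (pole c') (rsubmx w') ->
      param c' w' = param c w].

Lemma warped_riemannian : riemannian M.
Proof.
split=> //.
- by move=> c; rewrite domE; exact: open_tcoord.
- move=> c u v cu cv /inj -/(_ cu cv)[tuv /stereo_ptK yuv].
  by rewrite -[u]hsubmxK -[v]hsubmxK yuv [lsubmx u]mx11_scalar
    [lsubmx v]mx11_scalar -!/(tcoord _) tuv.
- move=> c c' u v cu cv uv.
  have [s [fs tv yv par]] := overlap cu cv uv.
  have oD : open [set w : 'rV[R]_(1 + m) | D c' (tcoord w + s)].
    apply: (@open_comp _ _ (fun w : 'rV[R]_(1 + m) => tcoord w + s) (D c')) => //.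
    move=> w _; apply: differentiable_continuous.
    by have [] := has_gradD (has_grad_tcoord w) (has_grad_cst s w).
  have Dv : D c' (tcoord u + s) by move: cv; rewrite domE /= tv.
  have elemT U : elem U (fun w : 'rV[R]_(1 + m) => tcoord w + s).
    apply: elemD; last exact: elem_cst.
    rewrite (_ : @tcoord R m = fun w => w 0 T); first exact: elem_coord.
    by apply/funext => w; rewrite /tcoord mxE.
  (* With equal poles the sphere coordinates agree; with opposite poles they are related by the
     inversion. *)
  have [ec|ec] := eqVneq (pole c) (pole c').
    have yuv : rsubmx v = rsubmx u.
      by apply/esym; apply: (@stereo_ptK _ _ (pole c)); rewrite yv ec.
    exists [set w | D c' (tcoord w + s)], (glue s id).
    have guv : glue s id u = v by exact: eq_glue.
    split=> //.
    + by move=> w Dw; split; [rewrite domE /= tcoord_glue|apply: par;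
        rewrite ?tcoord_glue ?rsubmx_glue ?ec].
    + move=> j; apply: elem_smooth => //; case: (split_ordP j) => k ->.
        rewrite ord1 (_ : (fun _ => _) = fun w => tcoord w + s)//.
        by apply/funext => w; rewrite glueT.
      rewrite (_ : (fun _ => _) = fun w => w 0 (S k)); first exact: elem_coord.
      by apply/funext => w; rewrite glueS mxE.
    + rewrite !tensorE -guv.
      apply: (glue_isometry (e := fun k i => (i == k)%:R)) => //.
        by move=> k; exact: has_grad_coord.
      by move=> i j; congr (_ * _); rewrite sum_delta eq_sym.
  have ec' : pole c' = ~~ pole c by move: ec; case: (pole c); case: (pole c').
  move: (yv); rewrite ec' => /stereo_pt_opposite[s0 yuv].
  set sigma : 'rV[R]_m -> 'rV[R]_m := fun y => (normsq y)^-1 *: y.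
  (* The centre is removed: there the inversion takes a default value and is not the coordinate
     change. *)
  exists ([set w | D c' (tcoord w + s)] `&` [set w | 0 < normsq (rsubmx w)]),
    (glue s sigma).
  have guv : glue s sigma u = v by exact: eq_glue.
  have oU : open ([set w : 'rV[R]_(1 + m) | D c' (tcoord w + s)] `&`
    [set w | 0 < normsq (rsubmx w)]) by apply: openI => //; exact: open_normsq.
  split=> //.
  + move=> w [Dw sw]; split; first by rewrite domE /= tcoord_glue.
    by apply: par; rewrite ?tcoord_glue ?rsubmx_glue// ec' stereo_pt_inversion.
  + move=> j; apply: elem_smooth => //; case: (split_ordP j) => k ->.
      rewrite ord1 (_ : (fun _ => _) = fun w => tcoord w + s)//.
      by apply/funext => w; rewrite glueT.
    rewrite (_ : (fun _ => _) = fun w => (normsq (rsubmx w))^-1 * w 0 (S k)).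
      apply: elemM; last exact: elem_coord.
      apply: elemV; last exact: elem_normsq.
      by move=> w [_ /= sw]; rewrite gt_eqF.
    by apply/funext => w; rewrite glueS /sigma !mxE.
  + rewrite !tensorE -guv; apply: (glue_isometry _ _ fs).
      by move=> k; exact: inversion_grad.
    move=> i j; rewrite conf_inversion//.
    set y := rsubmx u; set q := normsq y.
    have q0 : q != 0 by rewrite gt_eqF.
    (* The Jacobian of the inversion is 1/q times a reflection, hence its Gram matrix is q^-2 times
       the identity, which cancels the factor q^2 from the conformal factor at the image point. *)
    transitivity ((q * conf y) ^+ 2 * (
      q ^- 2 * (\sum_k (i == k)%:R * (j == k)%:R)
      - 2 * y 0 j / q ^+ 3 * (\sum_k y 0 k * (i == k)%:R)
      - 2 * y 0 i / q ^+ 3 * (\sum_k y 0 k * (j == k)%:R)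
      + 4 * y 0 i * y 0 j / q ^+ 4 * \sum_k y 0 k * y 0 k)).
      congr (_ * _); rewrite !mulr_sumr -!(sumrB, big_split)/=.
      by apply: eq_bigr => k _; field.
    by rewrite !sum_delta -normsqE -/q; field.
- move=> c i j; have oc : open (dom c) by rewrite domE; exact: open_tcoord.
  apply: elem_smooth => //; rewrite tensorE.
  rewrite (_ : (fun _ => _) = fun w => wdiag f i w * cst (i == j)%:R w).
    by apply: elemM; [exact: elem_wdiag|exact: elem_cst].
  by apply/funext => w; rewrite warped_diag.
- move=> c u cu; rewrite tensorE; apply/matrixP => i j; rewrite mxE !warped_diag.
  by rewrite eq_sym; case: eqVneq => [->|_] //; rewrite !mulr0.
- move=> c u cu; rewrite tensorE; apply: (posdef_diagonal (warped_diag f _ u)) => i.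
  rewrite /wdiag; case: fintype.split => _ //.
  by rewrite mulr_gt0// exprn_even_gt0//= ?fn0// gt_eqF// conf_gt0.
Qed.

End Riemannian.

(** * The line and the circle as base *)

Section Instances.
Context (R : realType) (m : nat).

Lemma cos_periodic (x : R) (k : int) : cos (x + k%:~R * (2 * pi)) = cos x.
Proof.
have N (n : nat) (z : R) : cos (z + n%:R * (2 * pi)) = cos z.
  by rewrite mulr_natl [2 * pi]mulr_natl (periodicn (@cosD2pi R)).
case: k => n; first exact: N.
by rewrite -[in RHS](subrK (n.+1%:R * (2 * pi)) x) N NegzE mulrNz mulNr.
Qed.

Lemma pi_circleP (s t : R) :
  (\pi_(circle R) s = \pi_(circle R) t)%qT <-> exists k : int, t = s + k%:~R * (2 * pi).
Proof. by split => [/eqmodP/asboolP|h]; last apply/eqmodP/asboolP. Qed.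

(** The representative is arbitrary, but cos does not see the choice; this gives the function X on
    the circle. *)
Lemma cos_repr_circle (t : R) : cos (repr (\pi_(circle R)%qT t)) = cos t.
Proof.
have /pi_circleP[k {2}->] :
  (\pi_(circle R) (repr (\pi_(circle R) t)) = \pi_(circle R) t)%qT by rewrite reprK.
by rewrite cos_periodic.
Qed.

Variable f : R -> R.

Lemma line_cover (p : line_warped m f) : exists c u, dom c u /\ param c u = p.
Proof.
case: p => t x; have [b [y <-]] := stereo_pt_cover x.
exists b, (row_mx t%:M y); split=> //=.
by rewrite /tcoord row_mxKl row_mxKr mxE eqxx mulr1n.
Qed.

Lemma circle_cover (p : circle_warped m f) : exists c u, dom c u /\ param c u = p.
Proof.
case: p => q x; have [b [y <-]] := stereo_pt_cover x.
exists (repr q, b), (row_mx (repr q)%:M y) => /=.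
rewrite /covering /tcoord row_mxKl row_mxKr mxE eqxx mulr1n /= reprK; split=> //.
by have := pi_gt0 R; lra.
Qed.

Hypothesis fn0 : forall t, f t != 0.
Hypothesis felem : forall U : set 'rV[R]_(1 + m), elem U (fun u => f (tcoord u)).

Lemma line_riemannian : riemannian (line_warped m f).
Proof.
apply: (@warped_riemannian _ _ _ fn0 felem (line_warped m f) id (fun=> setT)) => //.
- by move=> c; exact: openT.
- exact: line_cover.
- by move=> c u v _ _ [tuv yuv]; split=> //; exact: val_inj.
- move=> c c' u v _ _ [tuv yuv]; exists 0; rewrite addr0.
  split=> //; [by move=> t; rewrite addr0|exact: val_inj|].
  by move=> w w' tw yw; rewrite /= tw addr0 yw.
Qed.

Hypothesis fper : forall t (k : int), f (t + k%:~R * (2 * pi)) = f t.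

Lemma circle_riemannian : riemannian (circle_warped m f).
Proof.
apply: (@warped_riemannian _ _ _ fn0 felem (circle_warped m f) snd
  (fun c => [set t | c.1 - pi < t < c.1 + pi])) => //.
- move=> c; rewrite (_ : [set _ | _] = `]c.1 - pi, c.1 + pi[%classic).
    exact: interval_open.
  by apply/seteqP; split=> t /=; rewrite in_itv.
- exact: circle_cover.
- move=> c u v /= cu cv [/pi_circleP[k tuv] yuv].
  split; last exact: val_inj.
  (* Two parameters in the same chart are less than 2 pi apart, so the integer k has absolute value
     less than 1. *)
  suff k0 : k = 0 by rewrite tuv k0 mul0r addr0.
  have p0 := pi_gt0 R.
  have : `|k%:~R| < (1 : R) by rewrite ltr_norml; apply/andP; split; nra.
  by rewrite -intr_norm -[1]/(1%:~R) ltr_int; case: (k) => [[]|].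
- move=> c c' u v /= cu cv [/pi_circleP[k tuv] yuv].
  exists (k%:~R * (2 * pi)); split=> //; first exact: val_inj.
  move=> w w' tw yw; rewrite /covering /= yw; congr (_, _).
  by apply/esym/pi_circleP; exists k.
Qed.

End Instances.

(** * Functions along curves, and lower bounds for length *)

Section Curves.
Context (R : realType) (n : nat).
Implicit Types (h : 'rV[R]_n -> R) (c : R -> 'rV[R]_n).

Lemma cvg_sumr (T : Type) (F : set_system T) {FF : Filter F} p
    (u : 'I_p -> T -> R) (l : 'I_p -> R) :
  (forall i, u i x @[x --> F] --> l i) ->
  \sum_i u i x @[x --> F] --> \sum_i l i.
Proof.
elim: p u l => [|p IH] u l ul.
  by under eq_fun do rewrite big_ord0; rewrite big_ord0; exact: cvg_cst.
under eq_fun do rewrite big_ord_recl; rewrite big_ord_recl.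
by apply: cvgD; [exact: ul|exact: IH (fun i => ul (lift ord0 i))].
Qed.

Lemma continuous_sum (V : topologicalType) p (F : 'I_p -> V -> R) x :
  (forall i, {for x, continuous (F i)}) ->
  {for x, continuous (fun z => \sum_i F i z)}.
Proof. by move=> cF; exact: cvg_sumr. Qed.

Lemma diff_partial h u (v : 'rV[R]_n) : differentiable h u ->
  'd h u v = \sum_i partial i h u * v 0 i.
Proof.
move=> dh; rewrite {1}(row_sum_delta v) linear_sum; apply: eq_bigr => i _.
by rewrite linearZ /partial deriveE//= mulrC.
Qed.

Lemma derive1_along h c s : differentiable h (c s) -> derivable c s 1 ->
  is_derive s 1 (h \o c) (\sum_i partial i h (c s) * derive1 c s 0 i).
Proof.
move=> dh /derivable1_diffP dc; have dhc := differentiable_comp dc dh.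
apply: DeriveDef; first exact/derivable1_diffP.
by rewrite deriveE// diff_comp//= diff_partial// derive1E'.
Qed.

End Curves.

Section WarpedLength.
Context (R : realType) (m : nat) (f : R -> R) (b : bool).
Hypothesis felem : forall U : set 'rV[R]_(1 + m), elem U (fun u => f (tcoord u)).
Implicit Types (c : R -> 'rV[R]_(1 + m)) (h : 'rV[R]_(1 + m) -> R).

Definition speed c (s : R) : R :=
  Num.sqrt (\sum_i wdiag f i (c s) * derive1 c s 0 i ^+ 2).

Lemma quadratic_warped (u v : 'rV[R]_(1 + m)) :
  (v *m warped_metric f b u *m v^T) 0 0 = \sum_i wdiag f i u * v 0 i ^+ 2.
Proof.
rewrite mxE; apply: eq_bigr => i _.
by rewrite (mulmx_diagonal (warped_diag f b u)) mxE; ring.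
Qed.

Section Curve.
Variable c : R -> 'rV[R]_(1 + m).
Hypothesis dc : forall s, derivable c s 1.
Hypothesis cc : continuous (derive1 c).

Let ccoord s i : {for s, continuous (fun z => derive1 c z 0 i)}.
Proof.
apply: (@continuous_comp _ _ _ (derive1 c) (fun v => v 0 i)); first exact: cc.
by apply: differentiable_continuous; exact: differentiable_coord.
Qed.

Let calong h s : differentiable h (c s) -> {for s, continuous (h \o c)}.
Proof.
move=> dh; apply: continuous_comp; last exact: differentiable_continuous.
by apply: differentiable_continuous; exact/derivable1_diffP.
Qed.

Lemma continuous_speed : continuous (speed c).
Proof.
move=> s; apply: continuous_comp; last exact: sqrt_continuous.
apply: continuous_sum => i; apply: continuousM; last first.
  by apply: continuousM; exact: ccoord.
apply: calong.
have [d _ hd] := elem_has_grad (elem_wdiag felem setT i).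
by have [] := hd (c s) I.
Qed.

(** The hypothesis on h bounds its derivative along the curve by the speed; integration over [0, 1]
    gives the claim. *)
Lemma length_ge h : elem setT h ->
  (forall u (v : 'rV[R]_(1 + m)),
    (\sum_i partial i h u * v 0 i) ^+ 2 <= \sum_i wdiag f i u * v 0 i ^+ 2) ->
  ((h (c 1) - h (c 0))%:E <=
   \int[lebesgue_measure]_(s in `[0%R, 1%R]) (speed c s)%:E)%E.
Proof.
move=> eh bh; have [d ed hd] := elem_has_grad eh.
pose H' s := \sum_i partial i h (c s) * derive1 c s 0 i.
have dH (s : R) : is_derive s 1 (h \o c) (H' s).
  by apply: derive1_along => //; have [] := hd (c s) I.
have cH' : continuous H'.
  move=> s; apply: continuous_sum => i; apply: continuousM; last exact: ccoord.
  apply: (calong (h := partial i h)).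
  have -> : partial i h = d i.
    by apply/funext => u; have [_ ->] := hd u I.
  have [e _ he] := elem_has_grad (ed i).
  by have [] := he (c s) I.
have cH : continuous (h \o c).
  by move=> s; apply: calong; have [] := hd (c s) I.
rewrite EFinB -(@continuous_FTC2 _ H' (h \o c) 0 1) ?ltr01//; first last.
- by move=> s _; rewrite derive1E; have [_ ->] := dH s.
- split.
  + by move=> s _; have [] := dH s.
  + by apply: cvg_at_right_filter; exact: cH.
  + by apply: cvg_at_left_filter; exact: cH.
- exact: continuous_subspaceT.
apply: le_integral => //.
- apply: continuous_compact_integrable; first exact: segment_compact.
  exact: continuous_subspaceT.
- apply: continuous_compact_integrable; first exact: segment_compact.
  exact/continuous_subspaceT/continuous_speed.
- move=> s _; rewrite lee_fin; apply: le_trans (ler_norm _) _.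
  by rewrite -sqrtr_sqr ler_wsqrtr// bh.
Qed.

End Curve.
End WarpedLength.

(** * Functions on the covering that do not increase distances *)

Section LineDistance.
Context (R : realType) (m : nat) (f : R -> R).
Hypothesis felem : forall U : set 'rV[R]_(1 + m), elem U (fun u => f (tcoord u)).
Local Notation M := (line_warped m f).
Local Notation T := (lshift m (0 : 'I_1)).
Local Notation S := (@rshift 1 m).

Lemma curve_lengthE (b : chart M) c : curve_length b c =
  (\int[lebesgue_measure]_(s in `[0%R, 1%R]) (speed f c s)%:E)%E.
Proof.
rewrite /curve_length; apply: eq_integral => s _.
by rewrite /speed -(quadratic_warped f b).
Qed.

(* The differential of F has norm at most one in every chart. *)
Definition contracting (F : M -> R) := forall b : chart M, exists h,
  [/\ elem setT h, forall u, F (param b u) = h u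
    & forall u (v : 'rV[R]_(1 + m)), (\sum_i partial i h u * v 0 i) ^+ 2 <=
        \sum_i wdiag f i u * v 0 i ^+ 2].

(** F is defined on the whole manifold, so its increments telescope over the pieces of the curve,
    each of which lies in one chart. *)
Lemma contracting_joined (F : M -> R) p q l : contracting F -> joined p q l ->
  ((F q - F p)%:E <= l)%E.
Proof.
move=> cF; elim=> [p'|b c q' l' [dc cc _] _ IH]; first by rewrite subrr.
have [h [eh Fh bh]] := cF b.
rewrite -(subrKA (F (param b (c 1)))) addrC EFinD; apply: leeD => //.
by rewrite curve_lengthE !Fh; exact: length_ge.
Qed.

Lemma contracting_dist (F : M -> R) p q : contracting F ->
  ((F q - F p)%:E <= riemannian_dist p q)%E.
Proof.
by move=> cF; apply: le_ereal_inf_tmp => l /= pql; exact: contracting_joined pql.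
Qed.

Lemma contracting_tcoord : contracting fst.
Proof.
move=> b; exists (@tcoord R m); split=> //.
  rewrite (_ : @tcoord R m = fun w => w 0 T); first exact: elem_coord.
  by apply/funext => w; rewrite /tcoord mxE.
move=> u v; have [_ pt] := has_grad_tcoord u.
rewrite !big_split_ord !big_ord1/= wdiagT pt eqxx !mul1r [X in _ + X]big1.
  rewrite addr0 lerDl; apply: sumr_ge0 => i _.
  by rewrite wdiagS mulr_ge0 ?sqr_ge0// mulr_ge0 ?sqr_ge0.
by move=> i _; rewrite pt eq_rlshift mul0r.
Qed.

(** With J the Jacobian of [stereo b], the sum of the squared components of v J is v (J J^T) v^T,
    and J J^T is the round metric. *)
Lemma stereo_grad_isometry b (y v : 'rV[R]_m) :
  \sum_k (\sum_i stereo_grad b y k i * v 0 i) ^+ 2 = conf y ^+ 2 * normsq v.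
Proof.
have dt k : differentiable (fun w => stereo b w 0 k) y.
  by have [] := has_grad_stereo b y k.
transitivity ((v *m round_metric b y *m v^T) 0 0); last first.
  by rewrite round_metricE mul_mx_scalar -scalemxAl mxE.
rewrite /round_metric mulmxA -mulmxA -trmx_mul mxE; apply: eq_bigr => k _.
rewrite [_^T _ _]mxE -expr2 mxE; congr (_ ^+ 2); apply: eq_bigr => i _.
rewrite (jacobian_partial i k dt).
by have [_ ->] := has_grad_stereo b y k; exact: mulrC.
Qed.

Variable kappa : R.
Hypothesis kappa0 : 0 < kappa.
Hypothesis kappaf : forall t, kappa <= f t.

(** The square of one component of the differential of [stereo b] is at most the sum over all
    components, and kappa <= f absorbs the warping. *)
Lemma contracting_sphere k : contracting (fun p => kappa * val p.2 0 k).
Proof.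
move=> b; exists (fun u => cst kappa u * stereo b (rsubmx u) 0 k); split=> //.
  apply: elemM; first exact: elem_cst.
  case: (split_ordP k) => j ->.
    rewrite (_ : (fun _ => _) = fun w => conf (rsubmx w) * w 0 (S j)).
      by apply: elemM; [exact: elem_conf|exact: elem_coord].
    by apply/funext => w; rewrite stereo_lshift mxE.
  rewrite ord1 (_ : (fun _ => _) = fun w => cst ((-1) ^+ b) w *
    (cst 1 w + - conf (rsubmx w))).
    apply: elemM; first exact: elem_cst.
    by apply: elemD; [exact: elem_cst|apply: elemN; exact: elem_conf].
  by apply/funext => w; rewrite stereo_rshift.
move=> u v; set y := rsubmx u.
have [_ ph] := has_gradM (has_grad_cst kappa u)
  (has_grad_rsubmx (has_grad_stereo b y k)).
rewrite !big_split_ord !big_ord1/= wdiagT ph (unsplitK (inl _)).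
rewrite mul0r mulr0 add0r mul0r add0r mul1r.
apply: ler_wpDl; first exact: sqr_ge0.
pose w : 'rV[R]_m := rsubmx v.
have -> : \sum_(i < m) wdiag f (S i) u * v 0 (S i) ^+ 2 =
    f (tcoord u) ^+ 2 * (conf y ^+ 2 * normsq w).
  rewrite normsqE !mulr_sumr; apply: eq_bigr => i _.
  by rewrite wdiagS mxE; ring.
under eq_bigr => i _ do rewrite ph (unsplitK (inr _)) mul0r add0r /cst -mulrA.
rewrite -mulr_sumr exprMn; apply: ler_pM; rewrite ?sqr_ge0//.
  by rewrite lerXn2r// ?nnegrE// ltW//; exact: lt_le_trans (kappaf _).
rewrite -(stereo_grad_isometry b) (bigD1 k)//=.
rewrite [X in X ^+ 2 <= _](_ : _ = \sum_i stereo_grad b y k i * w 0 i).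
  by rewrite lerDl; apply: sumr_ge0 => i _; exact: sqr_ge0.
by apply: eq_bigr => i _; rewrite [w 0 i]mxE.
Qed.

End LineDistance.

(** * Completeness of the covering *)

Section LineComplete.
Context (R : realType) (m : nat) (f : R -> R) (kappa K : R).
Hypothesis felem : forall U : set 'rV[R]_(1 + m), elem U (fun u => f (tcoord u)).
Hypothesis kappa0 : 0 < kappa.
Hypothesis kappaf : forall t, kappa <= f t.
Hypothesis fK : forall t, f t <= K.
Local Notation M := (line_warped m f).
Local Notation T := (lshift m (0 : 'I_1)).
Local Notation S := (@rshift 1 m).

(** The entry in the t direction is 1, and the sphere entries are at most 4 K^2 because f <= K and
    conf <= 2. *)
Definition wbound : R := 1 + K ^+ 2 * 4.

Lemma wdiag_le i (u : 'rV[R]_(1 + m)) : wdiag f i u <= wbound.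
Proof.
rewrite /wdiag /wbound; case: fintype.split => _.
  by rewrite lerDl mulr_ge0// sqr_ge0.
apply: ler_wpDl => //.
have f0 : 0 <= f (tcoord u) by rewrite ltW// (lt_le_trans kappa0).
have c2 : conf (rsubmx u) <= 2.
  rewrite /conf ler_pdivrMr ?normsq1_gt0//.
  by have := normsq_ge0 (rsubmx u); lra.
apply: ler_pM; rewrite ?sqr_ge0//.
  by rewrite lerXn2r// ?nnegrE// (le_trans f0).
rewrite (_ : 4 = 2 ^+ 2 :> R); last by ring.
by rewrite lerXn2r// ?nnegrE// ltW// conf_gt0.
Qed.

(** Charts of the line product have the whole space as domain, so the straight segment is an
    admissible curve. *)
Lemma dist_chart (b : chart M) (u v : 'rV[R]_(1 + m)) :
  (riemannian_dist (param b u) (param b v) <=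
   (Num.sqrt (wbound * \sum_i (v 0 i - u 0 i) ^+ 2))%:E)%E.
Proof.
set B := Num.sqrt _; pose c (s : R) : 'rV[R]_(1 + m) := u + s *: (v - u).
have dc s : is_derive s (1 : R) c (v - u).
  have h := is_diff_scalel s (v - u).
  have ds : is_derive s (1 : R) (fun s : R => s *: (v - u)) (v - u).
    apply: DeriveDef; first exact: diff_derivable.
    by rewrite deriveE// diff_val scale1r.
  by apply: is_derive_eq (is_deriveD (is_derive_cst u s (1 : R)) ds) _; rewrite add0r.
have dcE : derive1 c = cst (v - u).
  by apply/funext => s; rewrite derive1E; have [_ ->] := dc s.
have dc1 s : derivable c s 1 by have [] := dc s.
have cc : continuous (derive1 c) by rewrite dcE; exact: cst_continuous.
have c0 : c 0 = u by rewrite /c scale0r addr0.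
have c1 : c 1 = v by rewrite /c scale1r addrC subrK.
have J : @joined _ _ M (param (a := M) b (c 0)) (param (a := M) b (c 1))
    (curve_length (M := M) b c + 0)%E.
  by apply: joined_cons; [split|exact: joined_nil].
rewrite c0 c1 in J; apply: ge_ereal_inf; exists (curve_length b c + 0)%E => //.
rewrite adde0 curve_lengthE.
have -> : B%:E = (\int[lebesgue_measure]_(s in `[0%R, 1%R]) cst B%:E s)%E.
  rewrite integral_cst//= lebesgue_measure_itv /= lte_fin ltr01.
  by rewrite sube0 mule1.
apply: le_integral => //.
- apply: continuous_compact_integrable; first exact: segment_compact.
  exact/continuous_subspaceT/(continuous_speed felem dc1 cc).
- apply: (@continuous_compact_integrable _ (cst B)); first exact: segment_compact.
  exact/continuous_subspaceT/cst_continuous.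
- move=> s _; rewrite lee_fin ler_wsqrtr// mulr_sumr; apply: ler_sum => i _.
  by rewrite dcE !mxE ler_wpM2r ?sqr_ge0// wdiag_le.
Qed.

(** The one-sided bound of [contracting_dist], used in both orders of the indices, makes the real
    sequence F (x i) Cauchy. *)
Lemma contracting_cvg (F : M -> R) (x : nat -> M) : contracting F ->
  (forall e : R, 0 < e -> exists N, forall i j, (N <= i)%N -> (N <= j)%N ->
     (riemannian_dist (x i) (x j) < e%:E)%E) ->
  exists l : R, F (x i) @[i --> \oo] --> l.
Proof.
move=> cF cx.
suff /cvg_ex[l Fl] : cvg (F (x i) @[i --> \oo]) by exists l.
apply: R_complete; apply: cauchy_exP => e e0.
have [N hN] := cx e e0; exists (F (x N)); exists N => // i /= Ni.
change (is_true (`|F (x N) - F (x i)| < e)).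
rewrite ltr_norml; apply/andP; split.
  rewrite ltrNl opprB -lte_fin.
  exact: le_lt_trans (contracting_dist felem _ _ cF) (hN _ _ (leqnn N) Ni).
rewrite -lte_fin.
exact: le_lt_trans (contracting_dist felem _ _ cF) (hN _ _ Ni (leqnn N)).
Qed.

Lemma line_complete : riemannian_complete M.
Proof.
move=> x cx.
have [t xt] := contracting_cvg (@contracting_tcoord _ _ f) cx.
pose z i k : R := val (x i).2 0 k.
have /choice[l zl] : forall k : 'I_(m + 1), exists l : R, z i k @[i --> \oo] --> l.
  move=> k; have cF := contracting_sphere kappa0 kappaf k.
  have [l hl] := contracting_cvg cF cx.
  exists (kappa^-1 * l).
  rewrite (_ : z^~ k = fun i => kappa^-1 * (kappa * val (x i).2 0 k)).
    by apply: cvgM => //; exact: cvg_cst.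
  by apply/funext => i; rewrite mulKf// gt_eqF.
pose q : 'rV[R]_(m + 1) := \row_k l k.
(* The sphere is closed: the squared norm of the limit is the limit of squared norms equal to 1. *)
have sq : (q *m q^T) 0 0 == 1.
  have h : \sum_k z i k * z i k @[i --> \oo] --> \sum_k l k * l k.
    by apply: cvg_sumr => k; apply: cvgM.
  have h1 : \sum_k z i k * z i k @[i --> \oo] --> (1 : R).
    rewrite (_ : (fun _ => _) = cst 1); first exact: cvg_cst.
    apply/funext => i; rewrite /cst -(eqP (valP (x i).2)) mxE.
    by apply: eq_bigr => k _; rewrite mxE.
  rewrite mxE -(cvg_unique _ h h1)//; apply/eqP; apply: eq_bigr => k _.
  by rewrite !mxE.
(* This projection has its pole away from q, so the height of q is positive and that of x i is
   positive for large i. *)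
pose b := 0 < q 0 (rshift m 0).
have hq : 0 < height b q by rewrite /height /b; move: (q 0 _) => z0; case: (ltP 0 z0); lra.
have hx : height b (val (x i).2) @[i --> \oo] --> height b q.
  apply: cvgB; first exact: cvg_cst.
  by apply: cvgM; [exact: cvg_cst|rewrite mxE; exact: zl].
pose v : 'rV[R]_(1 + m) := row_mx t%:M (inv_stereo b q).
(* These are coordinates of x i only when the height is nonzero; the finitely many other terms do
   not affect the limit. *)
pose u i : 'rV[R]_(1 + m) := row_mx (x i).1%:M (inv_stereo b (val (x i).2)).
have uv k : u i 0 k @[i --> \oo] --> v 0 k.
  case: (split_ordP k) => j ->.
    rewrite ord1 row_mxEl mxE eqxx mulr1n.
    by under eq_fun do rewrite row_mxEl mxE eqxx mulr1n.
  rewrite row_mxEr mxE; under eq_fun do rewrite row_mxEr mxE.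
  apply: cvgM; first by apply: cvgV => //; rewrite gt_eqF.
  by rewrite !mxE; under eq_fun do rewrite mxE; exact: zl.
have pv : param (a := M) b v = (t, exist _ q sq).
  rewrite /= /tcoord row_mxKl row_mxKr mxE eqxx mulr1n; congr (_, _).
  by apply/val_inj/inv_stereoK => //=; rewrite gt_eqF.
have pu i : 0 < height b (val (x i).2) -> param (a := M) b (u i) = x i.
  move=> hi; rewrite /= /tcoord row_mxKl row_mxKr mxE eqxx mulr1n.
  rewrite [RHS]surjective_pairing; congr (_, _).
  apply/val_inj/inv_stereoK; last by rewrite gt_eqF.
  exact: (valP (x i).2).
have bound : Num.sqrt (wbound * \sum_k (v 0 k - u i 0 k) ^+ 2) @[i --> \oo] --> (0 : R).
  rewrite [X in _ --> X](_ : _ = Num.sqrt (wbound * 0)); last by rewrite mulr0 sqrtr0.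
  apply: continuous_cvg; first exact: sqrt_continuous.
  apply: cvgM; first exact: cvg_cst.
  suff h : \sum_k (v 0 k - u i 0 k) ^+ 2 @[i --> \oo] --> \sum_(k < 1 + m) (0 : R).
    by rewrite big1_eq in h.
  apply: cvg_sumr => k.
  have d0 : v 0 k - u i 0 k @[i --> \oo] --> (0 : R).
    by rewrite -(subrr (v 0 k)); apply: cvgB => //; exact: cvg_cst.
  by rewrite -[X in _ --> X](mulr0 0); exact: cvgM.
exists (param (a := M) b v) => e e0.
have [N _ hN] : \forall i \near \oo,
    (riemannian_dist (x i) (param (a := M) b v) < e%:E)%E.
  near=> i.
  rewrite -(pu i); last by near: i; exact: cvgr_gt hx _ hq.
  apply: le_lt_trans (dist_chart _ _ _) _; rewrite lte_fin.
  near: i; exact: cvgr_lt bound _ e0.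
by exists N.
Unshelve. all: by end_near. Qed.

End LineComplete.

Theorem theorem1p8 (R : realType) (n : nat) (hn : (3 <= n)%N) (delta : R) :
  let m := n.-1 in
  0 < delta -> delta < 1 / m%:R ->
  let a := m%:R * (1 - delta) / (1 - m%:R * delta) in
  let f := fun t : R => a - cos t in
  [/\ riemannian (circle_warped m f),
      sharply_ricci_pinched (circle_warped m f) delta,
      riemannian (line_warped m f),
      riemannian_complete (line_warped m f)
    & sharply_ricci_pinched (line_warped m f) delta].
Proof.
move=> m delta0 deltam a f.
have m2 : (2 <= m)%N by rewrite /m -ltnS prednK // (ltn_trans _ hn).
have aE : a = m%:R * (1 - delta) / (1 - m%:R * delta) by [].
have m2R : (2 : R) <= m%:R by rewrite ler_nat.
have am := pinching_radius_gt m2 delta0 deltam aE.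
have fn0 := f_neq0 m2 delta0 deltam aE.
have felem (U : set 'rV[R]_(1 + m)) : elem U (fun u => f (tcoord u)).
  apply: (@elemD _ _ _ (cst a)); first exact: elem_cst.
  apply: elemN; apply: elem_cos.
  rewrite (_ : @tcoord R m = fun w => w 0 (lshift m 0)).
    exact: elem_coord.
  by apply/funext => w; rewrite /tcoord mxE.
have fper (t : R) (k : int) : f (t + k%:~R * (2 * pi)) = f t.
  by rewrite /f cos_periodic.
have [x0 _] : exists x : sphere R m, True.
  by exists (stereo_pt false 0).
split.
- exact: circle_riemannian fn0 felem fper.
- apply: (atlas_pinched m2 delta0 deltam aE (M := circle_warped m f)
    (X := fun p => cos (repr p.1)) (pole := snd)) => //.
  + exact: circle_cover.
  + by move=> c u _; rewrite /= cos_repr_circle.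
  (* Equality holds, and Ricci is negative, at t = 0; Ricci is positive at t = pi. *)
  + by exists (\pi_(circle R)%qT 0, x0); rewrite /= cos_repr_circle cos0.
  + by exists (\pi_(circle R)%qT pi, x0); rewrite /= cos_repr_circle cospi.
- exact: line_riemannian fn0 felem.
(* These are the minimum and the maximum of f. *)
- apply: (@line_complete _ _ f (a - 1) (a + 1)) => //.
  + lra.
  + by move=> t; rewrite /f lerD2l lerN2 cos_le1.
  + by move=> t; rewrite /f lerD2l lerNl cos_geN1.
- apply: (atlas_pinched m2 delta0 deltam aE (M := line_warped m f)
    (X := fun p => cos p.1) (pole := id)) => //.
  + exact: line_cover.
  + by exists (0, x0); rewrite /= cos0.
  + by exists (pi, x0); rewrite /= cospi.
Qed.
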